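(* Let $(A_j)_{j\ge 1}$ be a sequence of independent random matrices in $GL(d,\mathbb R)$, $d\ge2$, which is uniformly bounded, logarithmically contracting on average, has regular distributions and has large supports, and suppose that $\sigma_n(x)\to\infty$ for a fixed unit vector $x\in\mathbb R^d$. Then for every sufficiently small $\epsilon>0$ and every $0<\delta_0<T$ there exist $c,C>0$ such that for all $n\ge1$ $$\sup_{\delta_0\le|t|\le T}\|\mathcal L_{1,it}^n\|_\epsilon\le Ce^{-cn}.$$
   Context: $\|\cdot\|$ denotes the Euclidean norm and the associated operator norm. $\mathbb P^{d-1}(\mathbb R)$ is the real projective space with its standard metric $d(\bar x,\bar y)=\frac{\|x\wedge y\|}{\|x\|\|y\|}$, on which $GL(d,\mathbb R)$ acts. The $A_j$ need not be identically distributed. $A_{j,n}=A_{j+n-1}\cdots A_j$; $S_n(x)=\ln\|A_n\cdots A_2A_1x\|$; $\sigma_n(x)=\sqrt{\mathrm{Var}(S_n(x))}$. $\mathrm{supp}(A)$ is the support of the law of $A$. For $A\in GL(d,\mathbb R)$ and $y\neq 0$, $\sigma(A,y)=\ln(\|Ay\|/\|y\|)$, viewed as a function of $y\in\mathbb P^{d-1}(\mathbb R)$. Operators: for $t\in\mathbb R$ and $g:\mathbb P^{d-1}(\mathbb R)\to\mathbb C$, $\mathcal L_{j,it}g(x)=\mathbb E[e^{it\sigma(A_j,x)}g(A_jx)]$ and $\mathcal L_{j,it}^n=\mathcal L_{j,it}\circ\mathcal L_{j+1,it}\circ\cdots\circ\mathcal L_{j+n-1,it}$. For $\epsilon\in(0,1]$,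 $v_\epsilon(g)$ is the Hölder constant of $g$ with exponent $\epsilon$ with respect to the metric $d$, and $\|g\|_\epsilon=\sup|g|+v_\epsilon(g)$; the norm of an operator on the space of $\epsilon$-Hölder functions is the operator norm induced by $\|\cdot\|_\epsilon$. Uniformly bounded: the random variables $N(A_j)=\max(\|A_j\|,\|A_j^{-1}\|)$, $j\ge1$, are bounded by a common constant (almost surely). Logarithmically contracting on average: there exist $n_0\in\mathbb N$ and $\delta_*>0$ such that $\sup_j\sup_{\bar x\ne\bar y}\mathbb E\left[\ln\left(\frac{d(A_{j,n_0}\bar x,A_{j,n_0}\bar y)}{d(\bar x,\bar y)}\right)\right]\le-\delta_*$, where $\bar x,\bar y\in\mathbb P^{d-1}(\mathbb R)$. Regular distributions: for every $\delta>0$, $\inf_{j\in\mathbb N}\inf_{a\in\mathrm{supp}(A_j)}\mathbb P(\|A_j-a\|\le\delta)>0$, and there exists $k=k_\delta\in\mathbb N$ such that $\inf_{j\in\mathbb N}\inf_{x,y\in\mathbb P^{d-1}(\mathbb R)}\mathbb P(d(A_{j,k}x,y)\le\delta)>0$. Large supports: for $\ell\in\mathbb N$ let $$\Gamma_{j,\ell}=\{\ln|c|-\ln|c'|:\ c,c'\in\mathbb R\setminus\{0\},\ \exists\, x,y\in\mathbb R^d\setminus\{0\},\ \|x\|=1,\ \exists\,\alpha,\beta\in\mathrm{supp}(A_{j,\ell}),\ \alpha x=cy,\ \beta x=c'y\}$$ and $\Delta_{j,\ell}=\{|s|:s\in\Gamma_{j,\ell}\}$. At least one of the following holds: (i) the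 supports of all $A_j$ are connected and there is $\ell_0\in\mathbb N$ with $\inf_j\sup(\Delta_{j,\ell_0})>0$; (ii) for every $r>1$ there exists $\ell_0\in\mathbb N$ such that $\inf_j\inf_{r^{-1}\le h\le r}\mathrm{dist}(\Gamma_{j,\ell_0},h\mathbb Z)>0$, where $\mathrm{dist}(\Gamma,h\mathbb Z)=\sup_{s\in\Gamma}\inf_{m\in\mathbb Z}|s-hm|$. *)

(* Defs.v *)
From HB Require Import structures.
From mathcomp Require Import all_boot all_order all_algebra finmap.
From mathcomp Require Import all_classical all_reals all_analysis.
From mathcomp Require Import complex.

Set Implicit Arguments.
Unset Strict Implicit.
Unset Printing Implicit Defensive.

Import Order.TTheory GRing.Theory Num.Theory.
Import numFieldNormedType.Exports.

Local Open Scope classical_set_scope.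
Local Open Scope ring_scope.

(* The norm that the library puts on matrices is the sup norm of the entries,
   so the Euclidean norm and its operator norm are defined here.  The topology
   of 'M[R]_d does not depend on this choice. *)
Definition enorm (R : realType) (n : nat) (x : 'cV[R]_n) : R :=
  Num.sqrt (\sum_(i < n) x i 0 ^+ 2).

(* [sup] is the least upper bound in R; for 0 < d the set is nonempty and
   bounded. *)
Definition opnorm (R : realType) (d : nat) (a : 'M[R]_d) : R :=
  sup [set enorm (a *m x) | x in [set x : 'cV[R]_d | enorm x = 1]].

(* ||x /\ y|| for the Euclidean norm of the second exterior power, in the
   orthonormal basis e_i /\ e_j with i < j. *)
Definition wedge_norm (R : realType) (n : nat) (x y : 'cV[R]_n) : R :=
  Num.sqrt (\sum_(i < n) \sum_(j < n | (i < j)%N)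
              (x i 0 * y j 0 - x j 0 * y i 0) ^+ 2).

Definition max_norm (R : realType) (d : nat) (a : 'M[R]_d) : R :=
  Num.max (opnorm a) (opnorm (invmx a)).

Definition projspace (R : realType) (d : nat) :=
  {V : {vspace 'cV[R]_d} | \dim V == 1%N}.

(* A nonzero vector on the line p.  The functions [pdist] and [cocycle] below
   take the same value for every nonzero vector on the line. *)
Definition repr_vec (R : realType) (d : nat) (p : projspace R d) : 'cV[R]_d :=
  vpick (val p).

(* The image of the line under a; [insubd] returns p itself when that image is
   not a line, which does not happen for invertible a. *)
Definition pact (R : realType) (d : nat) (a : 'M[R]_d) (p : projspace R d)
  : projspace R d :=
  insubd p (linfun (mulmx a) @: val p)%VS.

Lemma repr_vec_neq0 (R : realType) (d : nat) (p : projspace R d) :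
  repr_vec p != 0.
Proof. by rewrite vpick0 -dimv_eq0 (eqP (valP p)). Qed.

Lemma val_repr_vec (R : realType) (d : nat) (p : projspace R d) :
  val p = <[repr_vec p]>%VS.
Proof.
apply/eqP; rewrite eq_sym eqEdim -memvE memv_pick dim_vline repr_vec_neq0.
by rewrite (eqP (valP p)).
Qed.

Lemma val_pact (R : realType) (d : nat) (a : 'M[R]_d) (p : projspace R d) :
  a \in unitmx -> val (pact a p) = <[a *m repr_vec p]>%VS.
Proof.
move=> ua; rewrite /pact val_insubd val_repr_vec limg_line lfunE /= dim_vline.
have a0 : a *m repr_vec p != 0.
  apply: contraNneq (repr_vec_neq0 p) => h.
  by rewrite -(mulKmx ua (repr_vec p)) h mulmx0.
by rewrite a0 eqxx.
Qed.

Definition pdist (R : realType) (d : nat) (p q : projspace R d) : R :=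
  wedge_norm (repr_vec p) (repr_vec q)
    / (enorm (repr_vec p) * enorm (repr_vec q)).

Definition cocycle (R : realType) (d : nat) (a : 'M[R]_d)
    (p : projspace R d) : R :=
  ln (enorm (a *m repr_vec p) / enorm (repr_vec p)).

Definition borel_mx (R : realType) (d : nat) : set (set 'M[R]_d) :=
  <<s [set U : set 'M[R]_d | open U] >>.

Definition random_GL (R : realType) (d : nat) (disp : measure_display)
    (T : measurableType disp) (X : T -> 'M[R]_d) : Prop :=
  (forall w, X w \in unitmx) /\
  (forall B : set 'M[R]_d, borel_mx B -> measurable (X @^-1` B)).

(* Sequences are indexed from 1; the entry of index 0 is never used. *)
Definition independent_seq (R : realType) (d : nat) (disp : measure_display)
    (T : measurableType disp) (P : probability T R)
    (A : nat -> T -> 'M[R]_d) : Prop :=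
  forall (J : {fset nat}) (B : nat -> set 'M[R]_d),
    (forall j, j \in J -> (0 < j)%N) ->
    (forall j, j \in J -> borel_mx (B j)) ->
    P (\bigcap_(j in [set` J]) (A j @^-1` B j)) =
      (\prod_(j <- J) P (A j @^-1` B j))%E.

(* A_{j,n} = A_{j+n-1} ... A_j *)
Fixpoint mxprod (R : realType) (d : nat) (T : Type) (A : nat -> T -> 'M[R]_d)
    (j n : nat) (w : T) {struct n} : 'M[R]_d :=
  if n is m.+1 then A (j + m)%N w *m mxprod A j m w else 1%:M.

Definition log_norm (R : realType) (d : nat) (T : Type)
    (A : nat -> T -> 'M[R]_d) (x : 'cV[R]_d) (n : nat) (w : T) : R :=
  ln (enorm (mxprod A 1 n w *m x)).

Definition sigma (R : realType) (d : nat) (disp : measure_display)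
    (T : measurableType disp) (P : probability T R)
    (A : nat -> T -> 'M[R]_d) (x : 'cV[R]_d) (n : nat) : R :=
  Num.sqrt (fine ('V_P[log_norm A x n])%E).

(* Support of the law of X, as a law on GL(d,R). *)
Definition supp (R : realType) (d : nat) (disp : measure_display)
    (T : measurableType disp) (P : probability T R) (X : T -> 'M[R]_d)
  : set 'M[R]_d :=
  [set a | a \in unitmx /\
           forall U : set 'M[R]_d, open U -> U a -> (0 < P (X @^-1` U))%E].

Definition uniformly_bounded (R : realType) (d : nat) (disp : measure_display)
    (T : measurableType disp) (P : probability T R)
    (A : nat -> T -> 'M[R]_d) : Prop :=
  exists K : R, forall j, (0 < j)%N -> {ae P, forall w, max_norm (A j w) <= K}.

Definition log_contracting (R : realType) (d : nat) (disp : measure_display)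
    (T : measurableType disp) (P : probability T R)
    (A : nat -> T -> 'M[R]_d) : Prop :=
  exists (n0 : nat) (delta : R), (0 < n0)%N /\ 0 < delta /\
    (ereal_sup [set ereal_sup
       [set 'E_P[fun w => ln (pdist (pact (mxprod A j n0 w) xy.1)
                                    (pact (mxprod A j n0 w) xy.2)
                              / pdist xy.1 xy.2)]
       | xy in [set xy : projspace R d * projspace R d | xy.1 <> xy.2]]
     | j in [set j | (0 < j)%N]] <= (- delta)%:E)%E.

Definition regular_distributions (R : realType) (d : nat)
    (disp : measure_display) (T : measurableType disp) (P : probability T R)
    (A : nat -> T -> 'M[R]_d) : Prop :=
  forall delta : R, 0 < delta ->
    (0 < ereal_inf [set ereal_inf
           [set P [set w | (opnorm (A j w - a) <= delta)%R]
           | a in supp P (A j)]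
         | j in [set j | (0 < j)%N]])%E /\
    exists k : nat, (0 < k)%N /\
      (0 < ereal_inf [set ereal_inf
             [set P [set w | (pdist (pact (mxprod A j k w) xy.1) xy.2
                              <= delta)%R]
             | xy in [set: projspace R d * projspace R d]]
           | j in [set j | (0 < j)%N]])%E.

Definition Gamma (R : realType) (d : nat) (disp : measure_display)
    (T : measurableType disp) (P : probability T R)
    (A : nat -> T -> 'M[R]_d) (j l : nat) : set R :=
  [set s | exists c c' : R, [/\ c != 0, c' != 0, s = ln `|c| - ln `|c'| &
     exists x y : 'cV[R]_d, [/\ x != 0, y != 0, enorm x = 1 &
     exists alpha beta : 'M[R]_d,
       [/\ supp P (mxprod A j l) alpha, supp P (mxprod A j l) beta,
           alpha *m x = c *: y & beta *m x = c' *: y]]]].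

Definition Delta (R : realType) (d : nat) (disp : measure_display)
    (T : measurableType disp) (P : probability T R)
    (A : nat -> T -> 'M[R]_d) (j l : nat) : set R :=
  [set `|s| | s in Gamma P A j l].

Definition dist_lattice (R : realType) (G : set R) (h : R) : \bar R :=
  ereal_sup [set ereal_inf [set (`|s - h * m%:~R|)%:E | m in [set: int]]
            | s in G].

Definition large_supports (R : realType) (d : nat) (disp : measure_display)
    (T : measurableType disp) (P : probability T R)
    (A : nat -> T -> 'M[R]_d) : Prop :=
  ((forall j, (0 < j)%N -> connected (supp P (A j))) /\
   exists l0 : nat, (0 < l0)%N /\
     (0 < ereal_inf [set ereal_sup [set s%:E | s in Delta P A j l0]
                    | j in [set j | (0 < j)%N]])%E)
  \/
  (forall r : R, 1 < r ->
   exists l0 : nat, (0 < l0)%N /\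
     (0 < ereal_inf [set ereal_inf
            [set dist_lattice (Gamma P A j l0) h
            | h in [set h : R | (r^-1 <= h <= r)%R]]
          | j in [set j | (0 < j)%N]])%E).

(* The operator L_{j,it}; the expectation of a complex variable is taken
   separately on the real and imaginary parts. *)
Definition expi (R : realType) (s : R) : R[i] := Complex (cos s) (sin s).

Definition cexpectation (R : realType) (disp : measure_display)
    (T : measurableType disp) (P : probability T R) (Z : T -> R[i]) : R[i] :=
  Complex (fine ('E_P[fun w => complex.Re (Z w)])%E)
          (fine ('E_P[fun w => complex.Im (Z w)])%E).

Definition transfer (R : realType) (d : nat) (disp : measure_display)
    (T : measurableType disp) (P : probability T R)
    (A : nat -> T -> 'M[R]_d) (t : R) (j : nat) (g : projspace R d -> R[i])
  : projspace R d -> R[i] :=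
  fun x => cexpectation P
    (fun w => expi (t * cocycle (A j w) x) * g (pact (A j w) x)).

(* L_j o L_{j+1} o ... o L_{j+n-1} *)
Fixpoint transfer_iter (R : realType) (d : nat) (disp : measure_display)
    (T : measurableType disp) (P : probability T R)
    (A : nat -> T -> 'M[R]_d) (t : R) (j n : nat) (g : projspace R d -> R[i])
    {struct n} : projspace R d -> R[i] :=
  if n is m.+1 then transfer P A t j (transfer_iter P A t j.+1 m g) else g.

Definition cabs (R : realType) (z : R[i]) : R := ComplexField.Normc.normc z.

Definition holder_const (R : realType) (d : nat) (eps : R)
    (g : projspace R d -> R[i]) : \bar R :=
  ereal_sup [set (cabs (g xy.1 - g xy.2) / (pdist xy.1 xy.2 `^ eps))%:E
            | xy in [set xy : projspace R d * projspace R d | xy.1 <> xy.2]].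

(* Finite exactly on the eps-Hoelder functions. *)
Definition holder_norm (R : realType) (d : nat) (eps : R)
    (g : projspace R d -> R[i]) : \bar R :=
  (ereal_sup [set (cabs (g x))%:E | x in [set: projspace R d]]
   + holder_const eps g)%E.

Definition holder_opnorm (R : realType) (d : nat) (eps : R)
    (L : (projspace R d -> R[i]) -> (projspace R d -> R[i])) : \bar R :=
  ereal_sup [set holder_norm eps (L g)
            | g in [set g | (holder_norm eps g <= 1)%E]].

(* Main.v *)
Require Import Defs.
From HB Require Import structures.
From mathcomp Require Import all_boot all_order all_algebra finmap.
From mathcomp Require Import all_classical all_reals all_analysis.
From mathcomp Require Import measurable_realfun complex.
From mathcomp Require Import ring lra.

Set Implicit Arguments.
Unset Strict Implicit.
Unset Printing Implicit Defensive.

Import Order.TTheory GRing.Theory Num.Theory.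
Import numFieldNormedType.Exports.

Local Open Scope classical_set_scope.
Local Open Scope ring_scope.

(* Iterating the operators amounts to averaging [exp (i t sigma) g] over the products
   [A_{j,n}].  The logarithmic contraction makes some power of the projective distance
   contract on average, which yields a Lasota-Yorke inequality with constants
   independent of [j] and of [t] in a compact set; hence it is enough that the sup norm
   decreases by a definite factor after a fixed number of steps, for functions of
   bounded Hoelder norm.

   By the hitting condition it suffices that [|L^n g|] stays away from 1 at one point.
   A product [a] that brings two vectors [e1], [e2] close together in projective space
   almost annihilates a combination [e1 + s0 e2].  As [s] approaches [s0], the norm of
   [a (e1 + s e2)] decreases over a wide range of scales while its direction hardly
   moves, so the phase [t ln |a (e1 + s e2)|] turns by [pi] between two points that are
   still close and have close images.  This is incompatible with the Hoelder continuity
   of [g] and of [L^n g] if [|L^n g|] is almost 1, since then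
   [exp (i t sigma (a, x)) g (a x)] is almost [L^n g x]. *)

(** * Euclidean and projective geometry *)

(** The operators vary with [j], so no spectral argument for a single operator applies. What
    replaces it is one class of functions, sup norm at most 1 and Hoelder constant at most [V], that
    a block of [N] operators starting at any [j] maps into [1 - k2] times itself; linearity does the
    rest. That the twists are close to [L^n g] is a variance bound: if [|Z| <= 1] has mean [y], then
    the mean of [|Z - y|^2] is at most [1 - |y|^2]. This bound holds for one point [p] at a time,
    with an exceptional event depending on [p], whereas the two points to be compared depend on the
    random product. Hence the two points are only required to lie in windows of a definite length,
    and a finite grid meets every such window. The size of the grid depends only on the bound
    [K ^+ n] for the products, so one product is good for all grid points at once. This dictates the
    order of the constants: the range of scales [E0] from [pi / delta0], then the precision [tau]
    from [V], [T0] and [E0], then the number of factors, then the grid, and only then the gap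
    [kappa]. *)

Section Euclid.
Context (R : realType) (n : nat).
Implicit Types (x y u v : 'cV[R]_n) (p q : projspace R n) (a b : 'M[R]_n).

Definition dotp x y : R := \sum_(i < n) x i 0 * y i 0.

Lemma dotpC x y : dotp x y = dotp y x.
Proof. by apply: eq_bigr => i _; rewrite mulrC. Qed.

Lemma dotpDl x y u : dotp (x + y) u = dotp x u + dotp y u.
Proof. by rewrite -big_split; apply: eq_bigr => i _; rewrite mxE mulrDl. Qed.

Lemma dotpZl s x u : dotp (s *: x) u = s * dotp x u.
Proof. by rewrite mulr_sumr; apply: eq_bigr => i _; rewrite mxE mulrA. Qed.

Lemma dotpDr x y u : dotp u (x + y) = dotp u x + dotp u y.
Proof. by rewrite !(dotpC u) dotpDl. Qed.

Lemma dotpZr s x u : dotp u (s *: x) = s * dotp u x.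
Proof. by rewrite !(dotpC u) dotpZl. Qed.

Definition dotpE := (dotpDl, dotpDr, dotpZl, dotpZr).

Lemma dotpxx_ge0 x : 0 <= dotp x x.
Proof. by apply: sumr_ge0 => i _; rewrite -expr2 sqr_ge0. Qed.

Lemma enormE x : enorm x = Num.sqrt (dotp x x).
Proof. by congr Num.sqrt; apply: eq_bigr => i _; rewrite expr2. Qed.

Lemma sqr_enorm x : enorm x ^+ 2 = dotp x x.
Proof. by rewrite enormE sqr_sqrtr ?dotpxx_ge0. Qed.

Lemma enorm_ge0 x : 0 <= enorm x.
Proof. exact: sqrtr_ge0. Qed.

Lemma enorm_eq0 x : (enorm x == 0) = (x == 0).
Proof.
apply/eqP/eqP => [x0|->]; last first.
  by rewrite enormE /dotp big1 ?sqrtr0 // => i _; rewrite mxE mul0r.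
have /eqP : dotp x x = 0 by rewrite -sqr_enorm x0 expr0n.
rewrite psumr_eq0; last by move=> i _; rewrite -expr2 sqr_ge0.
move=> /allP h; apply/matrixP => i j; rewrite mxE !ord1.
by have := h i; rewrite mem_index_enum -expr2 sqrf_eq0 => /(_ isT)/eqP.
Qed.

Lemma enorm_gt0 x : x != 0 -> 0 < enorm x.
Proof. by move=> x0; rewrite lt_def enorm_ge0 enorm_eq0 x0. Qed.

Lemma enormZ s x : enorm (s *: x) = `|s| * enorm x.
Proof. by rewrite !enormE !dotpE mulrA -expr2 sqrtrM ?sqr_ge0 // sqrtr_sqr. Qed.

Lemma enorm_normalize x : x != 0 -> enorm ((enorm x)^-1 *: x) = 1.
Proof.
move=> x0; rewrite enormZ ger0_norm ?invr_ge0 ?enorm_ge0 // mulVf //.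
by rewrite enorm_eq0.
Qed.

(** Lagrange's identity. The summand is symmetric in [i], [j] and vanishes on the diagonal, so the
    sum over [i < j] is half of the full double sum, which expands into products of dot products. *)
Lemma sqr_wedge_norm x y :
  wedge_norm x y ^+ 2 = dotp x x * dotp y y - dotp x y ^+ 2.
Proof.
rewrite sqr_sqrtr; last by do 2!(apply: sumr_ge0 => ? _); rewrite sqr_ge0.
pose F i j := (x i 0 * y j 0 - x j 0 * y i 0) ^+ 2.
have Fxx i : F i i = 0 by rewrite /F subrr expr0n.
have FC i j : F i j = F j i by rewrite /F -sqrrN opprB; congr (_ ^+ 2); ring.
have half : \sum_(i < n) \sum_(j < n | (j < i)%N) F i j
          = \sum_(i < n) \sum_(j < n | (i < j)%N) F i j.
  rewrite (exchange_big_dep predT) //=.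
  by apply: eq_bigr => i _; apply: eq_bigr => j _; rewrite FC.
have tot : \sum_(i < n) \sum_(j < n) F i j = 2 * \sum_(i < n) \sum_(j < n | (i < j)%N) F i j.
  rewrite mulr_natl mulr2n -{1}half -big_split; apply: eq_bigr => i _ /=.
  rewrite (bigID (fun j : 'I_n => (j < i)%N)) /=; congr (_ + _).
  rewrite (bigD1 i) /= ?ltnn // Fxx add0r; apply: eq_bigl => j.
  by rewrite -leqNgt ltn_neqAle andbC eq_sym.
apply: (mulfI (_ : 2 != 0 :> R)) => //; rewrite -tot /F /dotp.
pose G i j := x i 0 * x i 0 * (y j 0 * y j 0) + y i 0 * y i 0 * (x j 0 * x j 0)
              - 2 * (x i 0 * y i 0 * (x j 0 * y j 0)).
rewrite (eq_bigr (fun i => \sum_j G i j)); last first.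
  by move=> i _; apply: eq_bigr => j _; rewrite /G; ring.
rewrite (eq_bigr (fun i => x i 0 * x i 0 * dotp y y + y i 0 * y i 0 * dotp x x
                           - 2 * (x i 0 * y i 0 * dotp x y))); last first.
  by move=> i _; rewrite /G sumrB big_split /= -!mulr_sumr.
rewrite sumrB big_split /= -!mulr_suml -!mulr_sumr -mulr_suml -/(dotp x x) -/(dotp y y).
rewrite -/(dotp x y).
by ring.
Qed.

Lemma wedge_norm_ge0 x y : 0 <= wedge_norm x y.
Proof. exact: sqrtr_ge0. Qed.

Lemma wedge_normE x y :
  wedge_norm x y = Num.sqrt (dotp x x * dotp y y - dotp x y ^+ 2).
Proof. by rewrite -sqr_wedge_norm sqrtr_sqr ger0_norm // wedge_norm_ge0. Qed.

Lemma wedge_norm_le x y : wedge_norm x y <= enorm x * enorm y.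
Proof.
rewrite -(@ler_pXn2r _ 2) ?nnegrE ?mulr_ge0 ?enorm_ge0 ?wedge_norm_ge0 //.
by rewrite sqr_wedge_norm exprMn !sqr_enorm gerBl sqr_ge0.
Qed.

Lemma normr_dotp_le x y : `|dotp x y| <= enorm x * enorm y.
Proof.
rewrite -(@ler_pXn2r _ 2) ?nnegrE ?mulr_ge0 ?enorm_ge0 ?normr_ge0 //.
rewrite exprMn !sqr_enorm real_normK ?num_real // -subr_ge0 -sqr_wedge_norm.
exact: sqr_ge0.
Qed.

Lemma enormD x y : enorm (x + y) <= enorm x + enorm y.
Proof.
rewrite -(@ler_pXn2r _ 2) ?nnegrE ?addr_ge0 ?enorm_ge0 //.
rewrite sqr_enorm !dotpE (dotpC y x) sqrrD !sqr_enorm.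
have := le_trans (ler_norm _) (normr_dotp_le x y).
set s := dotp x y; rewrite mulr2n; set t := enorm x * enorm y; lra.
Qed.

Lemma ler_dist_enorm x y : `|enorm x - enorm y| <= enorm (x - y).
Proof.
have h u v : enorm u - enorm v <= enorm (u - v).
  by rewrite lerBlDr -{1}(subrK v u) enormD.
rewrite ler_norml h andbT lerNl opprB (le_trans (h _ _)) //.
by rewrite -opprB -scaleN1r enormZ normrN1 mul1r.
Qed.

Lemma wedge_norm_shear x y s : wedge_norm x (y + s *: x) = wedge_norm x y.
Proof. by rewrite !wedge_normE !dotpE (dotpC y x); congr Num.sqrt; ring. Qed.

Lemma wedge_normZ x y s t :
  wedge_norm (s *: x) (t *: y) = `|s| * `|t| * wedge_norm x y.
Proof.
rewrite !wedge_normE !dotpE -normrM -sqrtr_sqr -sqrtrM ?sqr_ge0 //.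
by congr Num.sqrt; ring.
Qed.

Lemma wedge_norm_pencil x y s t :
  wedge_norm (x + s *: y) (x + t *: y) = `|s - t| * wedge_norm x y.
Proof.
rewrite !wedge_normE !dotpE -sqrtr_sqr -sqrtrM ?sqr_ge0 // (dotpC y x).
by congr Num.sqrt; ring.
Qed.

(** Area of a parallelogram as base times height: the second factor is the component of [y]
    orthogonal to [x]. *)
Lemma wedge_norm_proj x y : x != 0 ->
  wedge_norm x y = enorm x * enorm (y - (dotp x y / dotp x x) *: x).
Proof.
move=> x0; have d0 : dotp x x != 0 by rewrite -sqr_enorm sqrf_eq0 enorm_eq0.
rewrite -scaleNr -(wedge_norm_shear _ _ (- (dotp x y / dotp x x))).
set z := y + _; have xz : dotp x z = 0.
  by rewrite /z !dotpE mulNr divfK // subrr.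
by rewrite wedge_normE xz expr0n subr0 sqrtrM ?dotpxx_ge0 // -!enormE.
Qed.

Lemma wedge_norm_eq0 x y : x != 0 -> wedge_norm x y = 0 ->
  y = (dotp x y / dotp x x) *: x.
Proof.
move=> x0; rewrite wedge_norm_proj // => /eqP.
rewrite mulf_eq0 !enorm_eq0 (negPf x0) /= subr_eq0 => /eqP //.
Qed.

Lemma enorm_le_sum x : enorm x <= \sum_(i < n) `|x i 0|.
Proof.
rewrite -(@ler_pXn2r _ 2) ?nnegrE ?enorm_ge0 ?sumr_ge0 // sqr_enorm expr2 mulr_suml.
apply: ler_sum => i _; rewrite -expr2 -real_normK ?num_real // expr2 ler_wpM2l //.
by rewrite (bigD1 i) //= lerDl sumr_ge0.
Qed.

(** The form in which a bound on [max_norm a] is used: it does not mention the inverse, and the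
    constants simply multiply along products. *)
Definition quasi_isometry (K : R) a :=
  forall x, enorm (a *m x) <= K * enorm x /\ enorm x <= K * enorm (a *m x).

Lemma quasi_isometry1 : quasi_isometry 1 1%:M.
Proof. by move=> x; rewrite mul1mx mul1r. Qed.

Lemma quasi_isometryM K L a b : 0 <= K -> 0 <= L ->
  quasi_isometry K a -> quasi_isometry L b -> quasi_isometry (K * L) (a *m b).
Proof.
move=> K0 L0 ha hb x; rewrite -mulmxA; have [a1 a2] := ha (b *m x).
have [b1 b2] := hb x; split.
  by rewrite (le_trans a1) // -mulrA ler_wpM2l.
by rewrite (le_trans b2) // (mulrC K) -mulrA ler_wpM2l.
Qed.

Lemma quasi_isometryV K a : a \in unitmx ->
  quasi_isometry K a -> quasi_isometry K (invmx a).
Proof. by move=> ua h x; have := h (invmx a *m x); rewrite mulKVmx // => -[]. Qed.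

Lemma mulmx_neq0 K a x : quasi_isometry K a -> x != 0 -> a *m x != 0.
Proof.
move=> h x0; have [_] := h x; apply: contraTneq => ->.
have -> : enorm (0 : 'cV[R]_n) = 0 by apply/eqP; rewrite enorm_eq0.
by rewrite mulr0 -ltNge enorm_gt0.
Qed.

(** Replacing [y] by its component orthogonal to [x] changes neither wedge norm, because a shear of
    the pair is carried by [a] to a shear of the images; after that the area is at most the product
    of the two lengths. *)
Lemma wedge_norm_mulmx K a x y : 0 <= K -> quasi_isometry K a -> 
  wedge_norm (a *m x) (a *m y) <= K ^+ 2 * wedge_norm x y.
Proof.
move=> K0 h; have [->|x0] := eqVneq x 0.
  suff w0 z : wedge_norm (0 : 'cV[R]_n) z = 0 by rewrite mulmx0 !w0 mulr0.
  by rewrite -(scale0r 0) -(scale1r z) wedge_normZ normr0 !mul0r.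
rewrite [in leRHS]wedge_norm_proj //.
set s := dotp x y / _.
rewrite -(wedge_norm_shear (a *m x) (a *m y) (- s)) scalemxAr -mulmxDr scaleNr.
rewrite (le_trans (wedge_norm_le _ _)) // expr2 mulrACA.
by rewrite ler_pM ?enorm_ge0 //; apply: (h _).1.
Qed.

Lemma vlineZ (s : R) x : s != 0 -> <[s *: x]>%VS = <[x]>%VS.
Proof.
move=> s0; apply/eqP; rewrite eqEdim -memvE memvZ ?memv_line //.
by rewrite !dim_vline scaler_eq0 (negPf s0) leqnn.
Qed.

Lemma repr_vec_line p u : val p = <[u]>%VS ->
  exists2 s : R, s != 0 & repr_vec p = s *: u.
Proof.
move=> pu; have /vlineP [s es] : repr_vec p \in <[u]>%VS by rewrite -pu memv_pick.
exists s => //.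
by apply: contraNneq (repr_vec_neq0 p) => s0; rewrite es s0 scale0r.
Qed.

Lemma mulmx_unit_neq0 a x : a \in unitmx -> x != 0 -> a *m x != 0.
Proof.
by move=> ua; apply: contraNneq => ax0; rewrite -(mulKmx ua x) ax0 mulmx0.
Qed.

Lemma val_pact_line a p u : a \in unitmx -> val p = <[u]>%VS ->
  val (pact a p) = <[a *m u]>%VS.
Proof.
move=> ua /repr_vec_line [s s0 es].
by rewrite val_pact // es -scalemxAr vlineZ.
Qed.

Lemma pactM a b p : a \in unitmx -> b \in unitmx ->
  pact (b *m a) p = pact b (pact a p).
Proof.
move=> ua ub; apply: val_inj => /=.
rewrite (val_pact_line ub (val_pact p ua)) mulmxA val_pact //.
by rewrite unitmx_mul ub.
Qed.

Lemma pact1 p : pact 1%:M p = p.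
Proof.
apply: val_inj; rewrite /= val_pact ?unitmx1 // mul1mx.
exact/esym/val_repr_vec.
Qed.

Lemma pdistE p q u v : u != 0 -> v != 0 ->
  val p = <[u]>%VS -> val q = <[v]>%VS ->
  pdist p q = wedge_norm u v / (enorm u * enorm v).
Proof.
move=> u0 v0 /repr_vec_line [s s0 ps] /repr_vec_line [t t0 qt].
rewrite /pdist ps qt wedge_normZ !enormZ mulrACA -mulf_div divff ?mul1r //.
by rewrite mulf_neq0 ?normr_eq0.
Qed.

Lemma cocycleE a p u : u != 0 -> val p = <[u]>%VS ->
  cocycle a p = ln (enorm (a *m u) / enorm u).
Proof.
move=> u0 /repr_vec_line [s s0 ps]; rewrite /cocycle ps -scalemxAr !enormZ.
by rewrite -mulf_div divff ?mul1r // normr_eq0.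
Qed.

Lemma pdist_ge0 p q : 0 <= pdist p q.
Proof. by rewrite divr_ge0 ?wedge_norm_ge0 ?mulr_ge0 ?enorm_ge0. Qed.

Lemma pdist_le1 p q : pdist p q <= 1.
Proof.
rewrite ler_pdivrMr ?mul1r ?wedge_norm_le //.
by rewrite mulr_gt0 ?enorm_gt0 ?repr_vec_neq0.
Qed.

Lemma pdistxx p : pdist p p = 0.
Proof. by rewrite /pdist wedge_normE -expr2 subrr sqrtr0 mul0r. Qed.

Lemma pdist_gt0 p q : p <> q -> 0 < pdist p q.
Proof.
move=> pq; rewrite lt_def pdist_ge0 andbT; apply/eqP => /eqP.
have [p0 q0] := (repr_vec_neq0 p, repr_vec_neq0 q).
rewrite /pdist mulf_eq0 invr_eq0 mulf_eq0 !enorm_eq0 (negPf p0) (negPf q0) !orbF.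
move=> /eqP/(wedge_norm_eq0 p0) qp; apply: pq; apply: val_inj.
rewrite /= !val_repr_vec qp; apply/eqP; rewrite eq_sym eqEdim -memvE.
rewrite memvZ ?memv_line // !dim_vline p0 /=.
by rewrite -qp q0.
Qed.

(** The wedge in the numerator and the product of norms in the denominator each contribute a factor
    [K ^+ 2]. *)
Lemma pdist_pact K a p q : 0 <= K -> a \in unitmx -> quasi_isometry K a ->
  pdist (pact a p) (pact a q) <= K ^+ 4 * pdist p q.
Proof.
move=> K0 ua h; have [p0 q0] := (repr_vec_neq0 p, repr_vec_neq0 q).
have [ap aq] := (mulmx_neq0 h p0, mulmx_neq0 h q0).
rewrite (pdistE ap aq) ?val_pact // /pdist.
rewrite ler_pdivrMr ?mulr_gt0 ?enorm_gt0 //.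
rewrite (le_trans (wedge_norm_mulmx _ _ K0 h)) //.
have key : enorm (repr_vec p) * enorm (repr_vec q)
    <= K ^+ 2 * (enorm (a *m repr_vec p) * enorm (a *m repr_vec q)).
  by rewrite expr2 mulrACA ler_pM ?enorm_ge0 //; apply: (h _).2.
have e : K ^+ 4 = K ^+ 2 * K ^+ 2 by rewrite -exprD.
have K2 : 0 <= K ^+ 2 by exact: sqr_ge0.
have w0 := wedge_norm_ge0 (repr_vec p) (repr_vec q).
have pq0 : 0 < enorm (repr_vec p) * enorm (repr_vec q) by rewrite mulr_gt0 ?enorm_gt0.
move: key; rewrite e; move: K2 w0 pq0 => {e h}.
move: (K ^+ 2) (wedge_norm _ _) (enorm (repr_vec p) * _) => c w b c0 w0 b0.
move: (enorm _ * _) => b' key.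
have -> : c * c * (w / b) * b' = c * (w * (c * b' / b)) by ring.
by rewrite ler_wpM2l // ler_peMr // ler_pdivlMr // mul1r.
Qed.

Lemma pdist_pact_ge K a p q : 0 <= K -> a \in unitmx -> quasi_isometry K a ->
  pdist p q <= K ^+ 4 * pdist (pact a p) (pact a q).
Proof.
move=> K0 ua h.
have uV : invmx a \in unitmx by rewrite unitmx_inv.
have id r : pact (invmx a) (pact a r) = r by rewrite -pactM // mulVmx // pact1.
by have := pdist_pact (pact a p) (pact a q) K0 uV (quasi_isometryV ua h); rewrite !id.
Qed.

(** The projective distance does not see the sign of a vector, so unit representatives with
    nonnegative dot product are chosen; for these the Euclidean distance is controlled by the wedge,
    and [ln z <= z - 1] turns it into a bound for the logarithms. *)
Lemma cocycle_Lipschitz K a p q : 0 <= K -> quasi_isometry K a ->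
  `|cocycle a p - cocycle a q| <= 2 * K ^+ 2 * pdist p q.
Proof.
move=> K0 h; have [p0 q0] := (repr_vec_neq0 p, repr_vec_neq0 q).
have [u [v [u1 v1 uv pu qv]]] : exists u v, [/\ enorm u = 1, enorm v = 1,
    0 <= dotp u v, val p = <[u]>%VS & val q = <[v]>%VS].
  pose u := (enorm (repr_vec p))^-1 *: repr_vec p.
  pose v := (enorm (repr_vec q))^-1 *: repr_vec q.
  have [eu ev] : enorm u = 1 /\ enorm v = 1 by rewrite !enorm_normalize.
  have pu : val p = <[u]>%VS.
    by rewrite vlineZ ?invr_eq0 ?enorm_eq0 // val_repr_vec.
  have qv : val q = <[v]>%VS.
    by rewrite vlineZ ?invr_eq0 ?enorm_eq0 // val_repr_vec.
  have [uv|uv] := lerP 0 (dotp u v); first by exists u, v.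
  exists u, ((-1) *: v); split => //.
  - by rewrite enormZ normrN1 mul1r.
  - by rewrite dotpZr mulN1r oppr_ge0 ltW.
  - by rewrite vlineZ // oppr_eq0 oner_eq0.
have [u0 v0] : u != 0 /\ v != 0 by rewrite -!enorm_eq0 u1 v1 oner_eq0.
have duu : dotp u u = 1 by rewrite -sqr_enorm u1 expr1n.
have dvv : dotp v v = 1 by rewrite -sqr_enorm v1 expr1n.
(* With [c = dotp u v] the squares are [2 - 2 c] and [4 (1 - c) (1 + c)]; here [0 <= c <= 1] is
   used. *)
have uvd : enorm (u - v) <= 2 * wedge_norm u v.
  rewrite -(@ler_pXn2r _ 2) ?nnegrE ?mulr_ge0 ?wedge_norm_ge0 ?enorm_ge0 //.
  rewrite exprMn sqr_wedge_norm sqr_enorm -scaleN1r !dotpE (dotpC v u) duu dvv.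
  have le1 : dotp u v <= 1.
    by rewrite (le_trans (ler_norm _)) // (le_trans (normr_dotp_le _ _)) // u1 v1 mulr1.
  by nra.
rewrite (cocycleE _ u0 pu) (cocycleE _ v0 qv) (pdistE u0 v0 pu qv) u1 v1 mulr1 !divr1.
move: uvd; set D := wedge_norm u v => uvd.
have key (x y : 'cV[R]_n) : enorm x = 1 -> enorm y = 1 -> enorm (x - y) <= 2 * D ->
    ln (enorm (a *m x)) - ln (enorm (a *m y)) <= 2 * K ^+ 2 * D.
  move=> x1 y1 xy.
  have ax : 0 < enorm (a *m x).
    by rewrite enorm_gt0 // (mulmx_neq0 h) // -enorm_eq0 x1 oner_eq0.
  have ay : 0 < enorm (a *m y).
    by rewrite enorm_gt0 // (mulmx_neq0 h) // -enorm_eq0 y1 oner_eq0.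
  rewrite -ln_div ?posrE //.
  rewrite (le_trans (_ : _ <= enorm (a *m x) / enorm (a *m y) - 1)) //.
    rewrite -[X in ln X](subrK 1) addrC le_ln1Dx //.
    by rewrite ltrBrDl subrr divr_gt0.
  rewrite lerBlDr -(ler_pM2r ay) divfK ?gt_eqF // mulrDl mul1r -lerBlDr.
  rewrite (le_trans (le_trans (ler_norm _) (ler_dist_enorm _ _))) //.
  rewrite -mulmxBr (le_trans (h _).1) // (le_trans (ler_wpM2l K0 xy)) //.
  have := (h y).2; rewrite y1.
  have D0 : 0 <= D by exact: wedge_norm_ge0.
  have KD : 0 <= K * D by rewrite mulr_ge0.
  move=> h1; have := ler_peMr KD h1; move: (enorm (a *m y)) => r.
  have -> : K * (2 * D) = 2 * (K * D) by ring.
  have -> : 2 * K ^+ 2 * D * r = 2 * (K * D * (K * r)) by ring.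
  by move=> hh; rewrite ler_wpM2l.
rewrite ler_norml key // andbT lerNl opprB key //.
by rewrite -opprB -scaleN1r enormZ normrN1 mul1r.
Qed.

Lemma cocycleM a b p : a \in unitmx -> b \in unitmx ->
  cocycle (b *m a) p = cocycle b (pact a p) + cocycle a p.
Proof.
move=> ua ub; have p0 := repr_vec_neq0 p.
have ap := mulmx_unit_neq0 ua p0; have bap := mulmx_unit_neq0 ub ap.
rewrite (cocycleE b ap (val_pact p ua)) /cocycle -mulmxA.
rewrite -lnM ?posrE ?divr_gt0 ?enorm_gt0 //.
by rewrite mulrA divfK // enorm_eq0.
Qed.

Lemma dim_vline_neq0 x : x != 0 -> \dim <[x]>%VS == 1%N.
Proof. by move=> x0; rewrite dim_vline x0. Qed.

Definition proj_line x (x0 : x != 0) : projspace R n :=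
  exist (fun V : {vspace 'cV[R]_n} => \dim V == 1%N) <[x]>%VS (dim_vline_neq0 x0).

Lemma val_proj_line x (x0 : x != 0) : val (proj_line x0) = <[x]>%VS.
Proof. by []. Qed.

End Euclid.

(** * Expectations and Borel functions on matrices *)

Section Mean.
Context (R : realType) (disp : measure_display) (T : measurableType disp)
  (P : probability T R).
Implicit Types (f g : T -> R).

Definition mean f : R := fine ('E_P[f])%E.

(** The bound is only almost sure, as in [uniformly_bounded]. It guarantees integrability, so that
    the [fine] in [mean] never hides an infinite value. *)
Definition ess_bounded f :=
  measurable_fun setT f /\ exists M, {ae P, forall w, `|f w| <= M}.

Lemma meanE f : mean f = (\int[P]_w f w)%R.
Proof. by rewrite /mean unlock. Qed.

Lemma ess_bounded_integrable f : ess_bounded f -> P.-integrable setT (EFin \o f).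
Proof.
move=> [mf [M hM]]; apply/integrableP; split; first exact/measurable_EFinP.
apply: (@le_lt_trans _ _ (\int[P]_w (`|M|)%:E)%E); last first.
  by rewrite integral_cst //= probability_setT mule1 ltry.
apply: ae_ge0_le_integral => //.
- by apply/measurable_EFinP; exact: measurableT_comp.
- apply: filterS hM => w hw _ /=.
  by rewrite lee_fin (le_trans hw) // ler_norm.
Qed.

Lemma ess_boundedW f M : measurable_fun setT f -> (forall w, `|f w| <= M) ->
  ess_bounded f.
Proof. by move=> mf h; split=> //; exists M; apply: aeW. Qed.

Lemma ess_bounded_cst c : ess_bounded (fun=> c).
Proof. exact: (@ess_boundedW _ `|c|). Qed.

Lemma ess_boundedD f g : ess_bounded f -> ess_bounded g ->
  ess_bounded (fun w => f w + g w).
Proof.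
move=> [mf [M hM]] [mg [N hN]]; split; first exact: measurable_funD.
exists (M + N); apply: filterS2 hM hN => w fM gN.
by rewrite (le_trans (ler_normD _ _)) // lerD.
Qed.

Lemma ess_boundedM f g : ess_bounded f -> ess_bounded g ->
  ess_bounded (fun w => f w * g w).
Proof.
move=> [mf [M hM]] [mg [N hN]]; split; first exact: measurable_funM.
exists (M * N); apply: filterS2 hM hN => w fM gN.
by rewrite normrM ler_pM.
Qed.

Lemma ess_boundedZ c f : ess_bounded f -> ess_bounded (fun w => c * f w).
Proof. by move=> bf; apply: ess_boundedM => //; exact: ess_bounded_cst. Qed.

Lemma ess_bounded_sum I (s : seq I) (F : I -> T -> R) :
  (forall i, ess_bounded (F i)) -> ess_bounded (fun w => \sum_(i <- s) F i w).
Proof.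
move=> h; elim: s => [|i s ih].
  by under eq_fun do rewrite big_nil; exact: ess_bounded_cst.
by under eq_fun do rewrite big_cons; exact: ess_boundedD.
Qed.

Lemma eq_mean f g : (forall w, f w = g w) -> mean f = mean g.
Proof. by move=> fg; congr mean; apply/funext. Qed.

Lemma mean_cst c : mean (fun=> c) = c.
Proof. by rewrite /mean -[fun=> c]/(cst c) expectation_cst. Qed.

Lemma meanD f g : ess_bounded f -> ess_bounded g ->
  mean (fun w => f w + g w) = mean f + mean g.
Proof.
move=> bf bg; rewrite !meanE RintegralD //; exact: ess_bounded_integrable.
Qed.

Lemma meanZ c f : ess_bounded f -> mean (fun w => c * f w) = c * mean f.
Proof. move=> bf; rewrite !meanE RintegralZl //; exact: ess_bounded_integrable. Qed.

Lemma mean_sum I (s : seq I) (F : I -> T -> R) : (forall i, ess_bounded (F i)) ->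
  mean (fun w => \sum_(i <- s) F i w) = \sum_(i <- s) mean (F i).
Proof.
move=> h; elim: s => [|i s ih].
  by under eq_fun do rewrite big_nil; rewrite big_nil mean_cst.
under eq_fun do rewrite big_cons; rewrite big_cons meanD ?ih //.
exact: ess_bounded_sum.
Qed.

Lemma mean_ge0 f : ess_bounded f -> {ae P, forall w, 0 <= f w} -> 0 <= mean f.
Proof.
move=> bf f0; have -> : mean f = mean (fun w => Num.max (f w) 0).
  have [mf _] := bf; rewrite !meanE; congr fine; apply: ae_eq_integral => //.
  - exact/measurable_EFinP.
  - apply/measurable_EFinP; apply: measurable_maxr => //.
  - by apply: filterS f0 => w fw _; rewrite max_l.
rewrite meanE; apply: Rintegral_ge0 => w _.
by rewrite le_max lexx orbT.
Qed.

Lemma ess_boundedB f g : ess_bounded f -> ess_bounded g ->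
  ess_bounded (fun w => f w - g w).
Proof.
move=> bf bg; under eq_fun do rewrite -mulN1r.
by apply: ess_boundedD => //; exact: ess_boundedZ.
Qed.

Lemma meanB f g : ess_bounded f -> ess_bounded g ->
  mean (fun w => f w - g w) = mean f - mean g.
Proof.
move=> bf bg; under eq_fun do rewrite -mulN1r.
by rewrite meanD ?meanZ ?mulN1r //; exact: ess_boundedZ.
Qed.

Lemma ler_mean f g : ess_bounded f -> ess_bounded g ->
  {ae P, forall w, f w <= g w} -> mean f <= mean g.
Proof.
move=> bf bg h; rewrite -subr_ge0 -meanB //; apply: mean_ge0.
  exact: ess_boundedB.
by apply: filterS h => w; rewrite subr_ge0.
Qed.

Lemma mean_le_cst f c : ess_bounded f -> {ae P, forall w, f w <= c} -> mean f <= c.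
Proof.
move=> bf h; rewrite -[leRHS]mean_cst; apply: ler_mean => //.
exact: ess_bounded_cst.
Qed.

(** The first moment method, through which one good product of matrices is later extracted from
    averages. *)
Lemma mean_lt_ex f c (Q : T -> Prop) : ess_bounded f ->
  {ae P, forall w, Q w} -> mean f < c -> exists2 w, Q w & f w < c.
Proof.
move=> bf hQ; apply: contraPP => /forall2NP nex; apply/negP; rewrite -leNgt.
rewrite -[leLHS]mean_cst; apply: ler_mean => //; first exact: ess_bounded_cst.
apply: filterS hQ => w Qw; have [//|/negP] := nex w.
by rewrite -leNgt.
Qed.

Lemma mean_indic (E : set T) : measurable E -> mean (\1_E) = fine (P E).
Proof. by move=> mE; rewrite /mean expectation_indic. Qed.

Lemma ess_bounded_indic (E : set T) : measurable E -> ess_bounded (\1_E).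
Proof.
move=> mE; apply: (@ess_boundedW _ 1); first exact: measurable_indic.
by move=> w; rewrite indicE; case: (_ \in _); rewrite ?normr1 ?normr0.
Qed.

Definition indep_events (E F : set T) := (P (E `&` F) = P E * P F)%E.

(** With [indep_events_bigcup], this makes the events independent of [E] a Dynkin system. *)
Lemma indep_eventsC E F : measurable E -> measurable F ->
  indep_events E F -> indep_events E (~` F).
Proof.
move=> mE mF; rewrite /indep_events => EF.
have EoF : (P E < +oo)%E by rewrite (le_lt_trans (probability_le1 P mE)) // ltry.
have eD : (P (E `\` F) = P E - P (E `&` F))%E by exact: measureD.
rewrite -setDE eD EF probability_setC //.
have [x [y [-> ->]]] : exists x y, P E = x%:E /\ P F = y%:E.
  by exists (fine (P E)), (fine (P F)); rewrite !fineK ?fin_num_measure.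
by rewrite -EFinM -!EFinB -EFinM mulrBr mulr1.
Qed.

Lemma indep_events_bigcup E (F : (set T)^nat) : measurable E ->
  (forall n, measurable (F n)) -> trivIset setT F ->
  (forall n, indep_events E (F n)) -> indep_events E (\bigcup_n F n).
Proof.
move=> mE mF tF hF; rewrite /indep_events setI_bigcupr.
have -> : P (\bigcup_n (E `&` F n)) = (\sum_(n <oo) P (E `&` F n))%E.
  apply: measure_semi_bigcup; first by move=> n; exact: measurableI.
    exact: trivIset_setIl.
  by apply: bigcup_measurable => n _; exact: measurableI.
have -> : P (\bigcup_n F n) = (\sum_(n <oo) P (F n))%E.
  by apply: measure_semi_bigcup => //; exact: bigcup_measurable.
have [x Ex] : exists x, P E = x%:E by exists (fine (P E)); rewrite fineK ?fin_num_measure.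
rewrite Ex -nneseriesZl //.
by apply: eq_eseriesr => n _; rewrite -Ex; exact: hF.
Qed.

End Mean.

Section Borel.
Context (R : realType) (d : nat).

(** The sigma-algebra is [borel_mx]; carrying it on a type makes [measurable_fun] and product
    measures available for random matrices. *)
Definition mx_borel := g_sigma_algebraType [set U : set 'M[R]_d | open U].

Lemma measurable_coord (i j : 'I_d) :
  measurable_fun setT (fun a : mx_borel => (a : 'M[R]_d) i j).
Proof.
apply: (measurability _ (RGenOpens.measurableE R)) => _ [B [x [y ->]] <-].
rewrite setTI; apply: sub_sigma_algebra => /=.
by apply: (open_comp _ (interval_open _ _)) => // a _; exact: coord_continuous.
Qed.

(** An open set of matrices is a countable union of boxes with rational centre and radius
    [1 / (k + 1)], and the preimage of a box is a finite intersection of conditions on single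
    entries. *)
Lemma measurable_mxP disp (S : measurableType disp) (f : S -> mx_borel) :
  (forall i j, measurable_fun setT (fun s => (f s : 'M[R]_d) i j)) ->
  measurable_fun setT f.
Proof.
move=> mf; apply: (@measurability _ _ _ mx_borel setT f [set U : set 'M[R]_d | open U] erefl).
move=> _ [U oU <-].
rewrite setTI.
pose box (q : 'M[rat]_d * nat) : set 'M[R]_d :=
  [set a | forall i j, `|a i j - ratr (q.1 i j)| < q.2.+1%:R^-1].
have mbox q : measurable (f @^-1` box q).
  pose F (ij : 'I_d * 'I_d) : set S :=
    [set s | `|(f s : 'M[R]_d) ij.1 ij.2 - ratr (q.1 ij.1 ij.2)| < q.2.+1%:R^-1].
  have -> : f @^-1` box q = \bigcap_(ij in [set: 'I_d * 'I_d]) F ij.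
    apply/seteqP; split=> s /= h; first by move=> [i j] _; exact: h.
    by move=> i j; exact: (h (i, j)).
  apply: fin_bigcap_measurable; first exact: finite_finset.
  move=> [i j] _; rewrite /F -[X in measurable X]setTI /=.
  apply: measurable_fun_ltr => //; apply: measurableT_comp => //.
  by apply: measurable_funB => //; exact: mf.
have -> : f @^-1` U = \bigcup_q (if pselect (box q `<=` U) then f @^-1` box q else set0).
  apply/seteqP; split => [s /= Us|s [q _]]; last first.
    by case: pselect => // qU /qU.
  have /nbhs_ballP [e /= e0 he] : nbhs (f s : 'M[R]_d) U by exact: open_nbhs_nbhs.
  (* Two points of a box of radius [1 / (k + 1)] differ by less than [2 / (k + 1)] in each entry, so
     a box containing [f s] stays in the [e]-ball around it. *)
  pose k := Num.truncn (2 / e); have k0 : 0 < k.+1%:R^-1 :> R by rewrite invr_gt0 ltr0n.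
  have ke : k.+1%:R^-1 * 2 < e.
    by rewrite mulrC ltr_pdivrMr ?ltr0n // mulrC -ltr_pdivrMr // truncnS_gt.
  have [c ec] : exists c : R, c = k.+1%:R^-1 by eexists.
  rewrite -ec in k0 ke.
  have /choice [q hq] : forall ij : 'I_d * 'I_d, exists r : rat,
      `|(f s : 'M[R]_d) ij.1 ij.2 - ratr r| < c.
    move=> [i j] /=; set x := (f s : 'M[R]_d) i j.
    have /rat_in_itvoo [r] : x - c < x + c by lra.
    rewrite in_itv /= => /andP[h1 h2]; exists r; rewrite ltr_norml; lra.
  exists (\matrix_(i, j) q (i, j), k) => //.
  case: pselect => [h|[]]; first by move=> i j; rewrite /= mxE -ec; exact: (hq (i, j)).
  move=> a ha; apply: (he a); split=> // i j; rewrite /ball /=.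
  have := ha i j; rewrite /= mxE -ec; have := hq (i, j) => /=; move=> h1 h2.
  apply: le_lt_trans ke.
  rewrite -(subrKA (ratr (q (i, j)))) (le_trans (ler_normD _ _)) //.
  by rewrite -(distrC (a i j)); lra.
apply: countable_bigcupT_measurable; first exact: countableP.
by move=> q; case: pselect => ? /=; [exact: mbox|exact: measurable0].
Qed.

Lemma measurable_mulmx disp (S : measurableType disp) (f g : S -> mx_borel) :
  measurable_fun setT f -> measurable_fun setT g ->
  measurable_fun setT (fun s => (f s : 'M[R]_d) *m (g s : 'M[R]_d) : mx_borel).
Proof.
move=> mf mg; apply: measurable_mxP => i j; under eq_fun do rewrite mxE.
apply: measurable_sum => k; apply: measurable_funM.
  exact: measurableT_comp (measurable_coord _ _) mf.
exact: measurableT_comp (measurable_coord _ _) mg.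
Qed.

End Borel.

(** * Products of independent matrices *)

Section Products.
Context (R : realType) (d : nat) (disp : measure_display)
  (T : measurableType disp) (P : probability T R).

(** Independence says that the joint law and the product of the laws agree on rectangles, hence
    everywhere; Tonelli then lets [X] be frozen while [Y] is averaged over a fresh copy [w']. *)
Lemma mean_Fubini (X Y : T -> mx_borel R d)
    (f : mx_borel R d * mx_borel R d -> R) (M : R) :
  measurable_fun setT X -> measurable_fun setT Y -> measurable_fun setT f ->
  (forall B C, measurable B -> measurable C ->
     indep_events P (X @^-1` B) (Y @^-1` C)) ->
  (forall z, `|f z| <= M) ->
  ess_bounded P (fun w => mean P (fun w' => f (X w, Y w'))) /\
  mean P (fun w => f (X w, Y w)) =
  mean P (fun w => mean P (fun w' => f (X w, Y w'))).
Proof.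
move=> mX mY mf hI fM.
pose X' : {mfun T >-> mx_borel R d} := HB.pack X (isMeasurableFun.Build _ _ _ _ _ mX).
pose Y' : {mfun T >-> mx_borel R d} := HB.pack Y (isMeasurableFun.Build _ _ _ _ _ mY).
have mZ : measurable_fun setT (fun w => (X w, Y w)) by exact: measurable_fun_pair.
pose Z' : {mfun T >-> (mx_borel R d * mx_borel R d)%type} :=
  HB.pack (fun w => (X w, Y w)) (isMeasurableFun.Build _ _ _ _ _ mZ).
(* Shifted by the bound [M] to be nonnegative, so that Tonelli applies; the shift is cancelled at
   the end. *)
pose g z := (f z + M)%:E.
have mg : measurable_fun setT g.
  by apply/measurable_EFinP; exact: measurable_funD.
have g0 z : (0 <= g z)%E.
  by rewrite lee_fin -lerBlDr sub0r; have := fM z; rewrite ler_norml => /andP[].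
have Zpm : forall D, measurable D ->
    (distribution P X' \x distribution P Y')%E D = distribution P Z' D.
  move=> D mD; apply: product_measure_unique => // B C mB mC.
pose F x := (\int[P]_w' g (x, Y w'))%E.
have FE x : fubini_F (distribution P Y') g x = F x.
  rewrite /fubini_F ge0_integral_distribution //.
  by apply: measurableT_comp => //; exact: measurable_fun_pair.
have mF : measurable_fun setT F.
  rewrite -(_ : fubini_F (distribution P Y') g = F); last exact/funext.
  exact: measurable_fun_fubini_tonelli_F.
have bfY x : ess_bounded P (fun w' => f (x, Y w')).
  apply: (@ess_boundedW _ _ _ _ _ M) => //.
  by apply: measurableT_comp => //; apply: measurable_fun_pair.
have key : (\int[P]_w g (X w, Y w) = \int[P]_w F (X w))%E.
  rewrite -[LHS](@ge0_integral_distribution _ _ _ _ _ P Z' g) //.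
  rewrite -(@eq_measure_integral _ _ _ _ (distribution P Z') (distribution P X' \x distribution P Y')%E); last first.
    by move=> D mD _; exact: Zpm.
  rewrite fubini_tonelli1 //.
  under eq_integral do rewrite FE.
  by rewrite ge0_integral_distribution // => x; apply: integral_ge0.
have FXE w : F (X w) = (mean P (fun w' => f (X w, Y w')) + M)%:E.
  rewrite /F /g meanE.
  under eq_integral do rewrite EFinD.
  rewrite integralD //=; last 2 first.
    exact: (ess_bounded_integrable (bfY _)).
    exact: (ess_bounded_integrable (ess_bounded_cst _ _)).
  have e : (\int[P]_w' M%:E = M%:E)%E by rewrite integral_cst //= probability_setT mule1.
  rewrite [in RHS]EFinD; congr (_ + _)%E; last exact: e.
  by rewrite fineK // integrable_fin_num //; exact: (ess_bounded_integrable (bfY _)).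
have bH : ess_bounded P (fun w => mean P (fun w' => f (X w, Y w'))).
  apply: (@ess_boundedW _ _ _ _ _ M).
    apply/measurable_EFinP.
    rewrite (_ : _ \o _ = fun w => (F (X w) - M%:E)%E); last first.
      by apply/funext => w /=; rewrite FXE -EFinB addrK.
    by apply: emeasurable_funB => //; exact: measurableT_comp mF mX.
  move=> w; rewrite ler_norml; apply/andP; split.
    rewrite -[leLHS](mean_cst P); apply: ler_mean => //; first exact: ess_bounded_cst.
    by apply: aeW => w'; have := fM (X w, Y w'); rewrite ler_norml => /andP[].
  apply: mean_le_cst => //; apply: aeW => w'.
  by have := fM (X w, Y w'); rewrite ler_norml => /andP[].
split => //; apply: (addIr M).
have bZ : ess_bounded P (fun w => f (X w, Y w)).
  by apply: (@ess_boundedW _ _ _ _ _ M) => //; exact: measurableT_comp mf mZ.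
rewrite -[in LHS](mean_cst P M) -[in RHS](mean_cst P M).
rewrite -!meanD //; try exact: ess_bounded_cst.
rewrite !meanE; congr fine.
by rewrite -[LHS]/(\int[P]_w g (X w, Y w))%E key; apply: eq_integral => w _; rewrite FXE.
Qed.

Variable A : nat -> T -> 'M[R]_d.
Hypothesis hGL : forall j, (0 < j)%N -> random_GL (A j).
Hypothesis hI : independent_seq P A.

Lemma mxprodD j n m w :
  mxprod A j (n + m) w = mxprod A (j + n) m w *m mxprod A j n w.
Proof.
elim: m => [|m ih]; first by rewrite addn0 mul1mx.
by rewrite addnS /= ih mulmxA addnA.
Qed.

Lemma mxprod1 j w : mxprod A j 1 w = A j w.
Proof. by rewrite /= mulmx1 addn0. Qed.

Lemma mxprod_unit j n w : (0 < j)%N -> mxprod A j n w \in unitmx.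
Proof.
move=> j0; elim: n => [|n ih] /=; first exact: unitmx1.
by rewrite unitmx_mul ih andbT (hGL _).1 // addn_gt0 j0.
Qed.

Lemma measurable_random j : (0 < j)%N ->
  measurable_fun setT (A j : T -> mx_borel R d).
Proof. by move=> j0 _ B mB; rewrite setTI; exact: (hGL j0).2. Qed.

Lemma measurable_mxprod j n : (0 < j)%N ->
  measurable_fun setT (mxprod A j n : T -> mx_borel R d).
Proof.
move=> j0; elim: n => [|n ih]; first exact: measurable_cst.
by apply: measurable_mulmx => //; apply: measurable_random; rewrite addn_gt0 j0.
Qed.

Let rect (J : {fset nat}) (B : nat -> set 'M[R]_d) : set T :=
  \bigcap_(j in [set` J]) (A j @^-1` B j).

Let mpre i (B : set 'M[R]_d) : (0 < i)%N -> borel_mx B -> measurable (A i @^-1` B).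
Proof. by move=> i0 mB; apply: (hGL i0).2. Qed.

(** Induction on the number of factors. The longer product is a Borel function of the pair of its
    last factor and the shorter product, so by the Dynkin argument rectangles for this pair suffice.
    On a rectangle the event of the last factor is absorbed into [H], which is why [H] is arbitrary
    in the induction. *)
Lemma mxprod_indep_events i m (H : set T) : (0 < i)%N -> measurable H ->
  (forall J B, (forall j, j \in J -> (i <= j < i + m)%N) ->
     (forall j, j \in J -> borel_mx (B j)) -> indep_events P H (rect J B)) ->
  forall C, borel_mx C -> indep_events P H (mxprod A i m @^-1` C).
Proof.
move=> i0; elim: m H => [|m ih] H mH hH C mC.
  rewrite /indep_events; have [C1|C1] := pselect (C 1%:M).
    have -> : mxprod A i 0 @^-1` C = setT by apply/seteqP; split.
    by rewrite setIT probability_setT mule1.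
  have -> : mxprod A i 0 @^-1` C = set0 by apply/seteqP; split.
  by rewrite setI0 measure0 mule0.
have im0 : (0 < i + m)%N by rewrite addn_gt0 i0.
have split_first J B (B' : nat -> set 'M[R]_d) : (forall j, j \in J -> (i <= j < i + m)%N) ->
    rect ((i + m)%N |` J)%fset (fun j => if j == (i + m)%N then B else B' j)
    = A (i + m)%N @^-1` B `&` rect J B'.
  move=> hJ; have ne j : j \in J -> (j == (i + m)%N) = false.
    by move=> /hJ /andP[_ h]; rewrite ltn_eqF.
  apply/seteqP; split => w.
    move=> h; split.
      by have := h (i + m)%N; rewrite /= !inE eqxx => /(_ isT).
    by move=> j /= Jj; have := h j; rewrite /= !inE Jj orbT ne // => /(_ isT).
  move=> [h1 h2] j /=; rewrite !inE => /predU1P[->|Jj]; first by rewrite eqxx.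
  by rewrite ne //; exact: h2.
have key H' B : measurable H' -> borel_mx B ->
    (forall J B, (forall j, j \in J -> (i <= j < i + m.+1)%N) ->
     (forall j, j \in J -> borel_mx (B j)) -> indep_events P H' (rect J B)) ->
    indep_events P H' (A (i + m)%N @^-1` B) /\
    forall C', borel_mx C' ->
      indep_events P (H' `&` A (i + m)%N @^-1` B) (mxprod A i m @^-1` C').
  move=> mH' mB hH'.
  have hJ1 (J : {fset nat}) (hJ : forall j, j \in J -> (i <= j < i + m)%N) j :
      j \in ((i + m)%N |` J)%fset -> (i <= j < i + m.+1)%N.
    rewrite !inE => /predU1P[->|/hJ /andP[-> h]]; first by rewrite leq_addr addnS ltnSn.
    by rewrite addnS ltnS ltnW.
  have single : indep_events P H' (A (i + m)%N @^-1` B).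
    have := split_first fset0 B (fun=> setT) => h0.
    have rect0 : rect fset0 (fun=> setT) = setT by apply/seteqP; split.
    rewrite rect0 setIT in h0; rewrite -h0 //; apply: hH'.
      by apply: hJ1 => j; rewrite inE.
    by move=> j _; case: ifP => // _; exact: (@measurableT _ (mx_borel R d)).
  split => //; apply: ih; first by apply: measurableI => //; exact: mpre.
  move=> J B' hJ mB'; rewrite /indep_events -setIA -split_first // hH'; last 2 first.
  - exact: hJ1.
  - by move=> j; rewrite !inE => /predU1P[->|Jj]; rewrite ?eqxx //; case: ifP => // _; exact: mB'.
  rewrite single -muleA; congr (_ * _)%E.
  have Jim : (i + m)%N \notin J by apply/negP => /hJ /andP[_]; rewrite ltnn.
  rewrite /rect !hI; last 4 first.
  - by move=> j /hJ /andP[h _]; exact: leq_trans h.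
  - exact: mB'.
  - by move=> j /(hJ1 J hJ) /andP[h _]; exact: leq_trans h.
  - by move=> j; rewrite !inE => /predU1P[->|Jj]; rewrite ?eqxx //; case: ifP => // _; exact: mB'.
  rewrite big_fsetU1 //= eqxx; congr (_ * _)%E.
  rewrite big_seq_cond [RHS]big_seq_cond; apply: eq_bigr => j; rewrite andbT => Jj.
  by rewrite ifF //; apply/negP => /eqP je; rewrite -je Jj in Jim.
pose X := A (i + m)%N : T -> mx_borel R d.
pose Y := mxprod A i m : T -> mx_borel R d.
have mX : measurable_fun setT X by exact: measurable_random.
have mY : measurable_fun setT Y by exact: measurable_mxprod.
have mZ : measurable_fun setT (fun w => (X w, Y w)) by exact: measurable_fun_pair.
suff prod D : measurable D -> indep_events P H ((fun w => (X w, Y w)) @^-1` D).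
  have mD : measurable_fun setT (fun z : mx_borel R d * mx_borel R d =>
      (z.1 : 'M[R]_d) *m (z.2 : 'M[R]_d) : mx_borel R d).
    by apply: measurable_mulmx; [exact: measurable_fst|exact: measurable_snd].
  have := prod _ (mD measurableT C mC); rewrite setTI; exact.
have mpreZ E : measurable E -> measurable ((fun w => (X w, Y w)) @^-1` E).
  by move=> mE; rewrite -[X in measurable X]setTI; exact: mZ.
rewrite measurable_prod_measurableType; move: D; apply: dynkin_induction.
- exact: measurable_prod_measurableType.
- move=> _ _ [B mB [C' mC' <-]] [B' mB' [C'' mC'' <-]].
  exists (B `&` B'); first exact: measurableI.
  by exists (C' `&` C''); [exact: measurableI|rewrite setXI].
- by rewrite preimage_setT /indep_events setIT probability_setT mule1.
- move=> _ [B mB [C' mC' <-]].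
  have -> : (fun w => (X w, Y w)) @^-1` (B `*` C')
          = A (i + m)%N @^-1` B `&` mxprod A i m @^-1` C' by apply/seteqP; split.
  have [e1 e2] := key H B mH mB hH.
  (* The case [H' = setT] of [key] is the mutual independence of the last factor and the shorter
     product, needed to recombine the two probabilities on the right. *)
  have [_ e3] : indep_events P setT (A (i + m)%N @^-1` B) /\ forall C', borel_mx C' ->
      indep_events P (setT `&` A (i + m)%N @^-1` B) (mxprod A i m @^-1` C').
    apply: key => // J B' _ _.
    by rewrite /indep_events setTI probability_setT mul1e.
  rewrite /indep_events setIA (e2 _ mC') e1 -muleA; congr (_ * _)%E.
  by have := e3 _ mC'; rewrite setTI => ->.
- by move=> S mS hS; rewrite preimage_setC; apply: indep_eventsC => //; exact: mpreZ.
- move=> F mF tF hF; rewrite preimage_bigcup; apply: indep_events_bigcup => //.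
    by move=> n; exact: mpreZ.
  by apply/trivIsetP => a b _ _ ab; rewrite -preimage_setI;
    move/trivIsetP: tF => /(_ _ _ _ _ ab) ->//; rewrite preimage_set0.
Qed.

(** [mxprod_indep_events] is used twice: first to replace the event of the later product by
    rectangles in the later factors, then, with such a rectangle as [H], to do the same for the
    earlier product. What remains is [independent_seq] for two disjoint index sets. *)
Lemma mxprod_indep j n m B C : (0 < j)%N -> borel_mx B -> borel_mx C ->
  indep_events P (mxprod A j n @^-1` B) (mxprod A (j + n) m @^-1` C).
Proof.
move=> j0 mB mC; have jn0 : (0 < j + n)%N by rewrite addn_gt0 j0.
have mpr : measurable (mxprod A j n @^-1` B).
  by rewrite -[X in measurable X]setTI; exact: (measurable_mxprod n j0).
apply: mxprod_indep_events => // J D hJ mD.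
have J0 i : i \in J -> (0 < i)%N by move=> /hJ /andP[h _]; exact: leq_trans h.
have mrect J' D' : (forall i, i \in J' -> (0 < i)%N) ->
    (forall i, i \in J' -> borel_mx (D' i)) -> measurable (rect J' D').
  move=> J'0 mD'; apply: fin_bigcap_measurable; first exact: finite_fset.
  by move=> i /= J'i; apply: mpre; [exact: J'0|exact: mD'].
suff : indep_events P (rect J D) (mxprod A j n @^-1` B).
  by rewrite /indep_events setIC muleC.
apply: mxprod_indep_events => //; first exact: mrect.
move=> J' D' hJ' mD'; have J'0 i : i \in J' -> (0 < i)%N.
  by move=> /hJ' /andP[h _]; exact: leq_trans h.
have dis : [disjoint J & J']%fset.
  apply/fdisjointP => i /hJ /andP[h _]; apply/negP => /hJ' /andP[_ h'].
  by move: (leq_trans h' h); rewrite ltnn.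
pose E i := if i \in J then D i else D' i.
have rE : rect J D `&` rect J' D' = rect (J `|` J')%fset E.
  apply/seteqP; split => w.
    move=> [h h'] i /=; rewrite in_fsetU /E; case: ifPn => [Ji _|_ /=]; first exact: h.
    exact: h'.
  move=> h; split => i /= Ji; have := h i; rewrite /= in_fsetU Ji ?orbT /E => /(_ isT).
    by rewrite Ji.
  by move/fdisjointP_sym : dis => /(_ i Ji) /negPf ->.
rewrite /indep_events rE /rect !hI //; last 2 first.
- by move=> i; rewrite in_fsetU => /orP[/J0|/J'0].
- move=> i; rewrite in_fsetU /E; case: ifPn => [Ji _|_ /=]; first exact: mD.
  exact: mD'.
have pe : perm_eq (J `|` J')%fset (enum_fset J ++ enum_fset J').
  apply: uniq_perm; rewrite ?cat_uniq ?fset_uniq //=.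
    rewrite andbT; apply/hasPn => i J'i; move/fdisjointP_sym : dis; exact.
  by move=> i; rewrite mem_cat in_fsetU.
rewrite (perm_big _ pe) big_cat /=; congr (_ * _)%E.
  by rewrite big_seq_cond [RHS]big_seq_cond; apply: eq_bigr => i; rewrite andbT /E => ->.
rewrite big_seq_cond [RHS]big_seq_cond; apply: eq_bigr => i; rewrite andbT /E => Ji.
by move/fdisjointP_sym : dis => /(_ i Ji) /negPf ->.
Qed.

Lemma mean_mxprodD j n m (f : mx_borel R d -> R) (M : R) : (0 < j)%N ->
  measurable_fun setT f -> (forall a, `|f a| <= M) ->
  ess_bounded P (fun w => mean P (fun w' =>
    f (mxprod A (j + n) m w' *m mxprod A j n w : 'M[R]_d))) /\
  mean P (fun w => f (mxprod A j (n + m) w)) =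
  mean P (fun w => mean P (fun w' =>
    f (mxprod A (j + n) m w' *m mxprod A j n w : 'M[R]_d))).
Proof.
move=> j0 mf fM; have jn0 : (0 < j + n)%N by rewrite addn_gt0 j0.
under [in X in _ /\ X]eq_fun do rewrite mxprodD.
apply: (@mean_Fubini (mxprod A j n) (mxprod A (j + n) m)
  (fun z => f ((z.2 : 'M[R]_d) *m (z.1 : 'M[R]_d))) M) => //.
- exact: measurable_mxprod.
- exact: measurable_mxprod.
- apply: (measurableT_comp (f := f) mf (g := fun z : mx_borel R d * mx_borel R d =>
    (z.2 : 'M[R]_d) *m (z.1 : 'M[R]_d) : mx_borel R d)).
  by apply: measurable_mulmx; [exact: measurable_snd|exact: measurable_fst].
- by move=> B C mB mC; exact: mxprod_indep.
Qed.

End Products.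

(** * Complex expectations *)

Section Complex.
Context (R : realType).
Implicit Types (z y : R[i]) (s t : R).

Lemma cabsE z : cabs z = Num.sqrt (complex.Re z ^+ 2 + complex.Im z ^+ 2).
Proof. by case: z. Qed.

Lemma cabs_ge0 z : 0 <= cabs z.
Proof. by rewrite cabsE sqrtr_ge0. Qed.

Lemma sqr_cabs z : cabs z ^+ 2 = complex.Re z ^+ 2 + complex.Im z ^+ 2.
Proof. by rewrite cabsE sqr_sqrtr // addr_ge0 ?sqr_ge0. Qed.

Lemma cabs0 : cabs (0 : R[i]) = 0.
Proof. by rewrite cabsE /= expr0n addr0 sqrtr0. Qed.

Lemma cabsM z y : cabs (z * y) = cabs z * cabs y.
Proof. exact: ComplexField.Normc.normcM. Qed.

Lemma cabsD z y : cabs (z + y) <= cabs z + cabs y.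
Proof. exact: le_normcD. Qed.

Lemma cabsN z : cabs (- z) = cabs z.
Proof. exact: normcN. Qed.

Lemma normr_Re_le z : `|complex.Re z| <= cabs z.
Proof.
rewrite -(@ler_pXn2r _ 2) ?nnegrE ?cabs_ge0 // sqr_cabs real_normK ?num_real //.
by rewrite lerDl sqr_ge0.
Qed.

Lemma normr_Im_le z : `|complex.Im z| <= cabs z.
Proof.
rewrite -(@ler_pXn2r _ 2) ?nnegrE ?cabs_ge0 // sqr_cabs real_normK ?num_real //.
by rewrite lerDr sqr_ge0.
Qed.

Lemma cabs_expi s : cabs (expi s) = 1.
Proof. by rewrite cabsE /= cos2Dsin2 sqrtr1. Qed.

Lemma expiD s t : expi (s + t) = expi s * expi t.
Proof. by rewrite /expi cosD sinD; apply/eqP; rewrite eq_complex /= (addrC (cos s * sin t)) !eqxx. Qed.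

Lemma expi0 : expi 0 = 1 :> R[i].
Proof. by rewrite /expi cos0 sin0. Qed.

Lemma expiDpi s : expi (s + pi) = - expi s.
Proof. by rewrite /expi cosDpi sinDpi. Qed.

Lemma normr_sin_le s : `|sin s| <= `|s|.
Proof.
have h t : 0 <= t -> `|sin t| <= t.
  move=> t0.
  have [|c _] := @MVT_segment _ sin cos 0 t t0.
    by apply: continuous_subspaceT => x; exact: continuous_sin.
  rewrite sin0 !subr0 => ->; rewrite normrM (ger0_norm t0) ler_piMl //.
  exact: cos_max.
have [s0|s0] := ger0P s; first exact: h.
by rewrite -[leLHS]normrN -sinN h // oppr_ge0 ltW.
Qed.

(** A chord is shorter than its arc: the square of the left side is [2 - 2 cos (s - t)], that is
    [4 sin^2 ((s - t) / 2)]. *)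
Lemma cabs_expiB s t : cabs (expi s - expi t) <= `|s - t|.
Proof.
rewrite -(@ler_pXn2r _ 2) ?nnegrE ?cabs_ge0 // sqr_cabs /=.
have e : (cos s - cos t) ^+ 2 + (sin s - sin t) ^+ 2
       = 2 - 2 * cos (s - t).
  rewrite cosB; have := cos2Dsin2 s; have := cos2Dsin2 t.
  move: (cos s) (sin s) (cos t) (sin t) => a b c f h1 h2.
  have -> : (a - c) ^+ 2 + (b - f) ^+ 2
    = (a ^+ 2 + b ^+ 2) + (c ^+ 2 + f ^+ 2) - 2 * (a * c + b * f) by ring.
  by rewrite h1 h2; ring.
rewrite e; set x := s - t.
have ex : x = x / 2 + x / 2 by field.
have := cos2Dsin2 (x / 2); have := normr_sin_le (x / 2).
rewrite [in cos x]ex cosD normrM (ger0_norm (_ : 0 <= 2^-1)) // => h1 h2.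
have : sin (x / 2) ^+ 2 <= (`|x| / 2) ^+ 2.
  by rewrite -real_normK ?num_real // ler_pXn2r ?nnegrE ?divr_ge0.
by move: (cos _) (sin _) h2 => a b h2; nra.
Qed.

Lemma powR_small (v eta eps : R) : 0 <= v -> 0 < eta -> 0 < eps ->
  exists delta, [/\ 0 < delta, delta <= 1 &
    forall s, 0 <= s -> s <= delta -> v * s `^ eps <= eta].
Proof.
move=> v0 eta0 eps0; have v1 : 0 < v + 1 by rewrite ltr_wpDl.
(* Dividing by [v + 1] instead of [v] covers [v = 0]. *)
pose r := (eta / (v + 1)) `^ eps^-1.
have r0 : 0 < r by rewrite powR_gt0 // divr_gt0.
exists (Num.min 1 r); split.
- by rewrite lt_min ltr01.
- by rewrite ge_min lexx.
move=> s s0; rewrite le_min => /andP[_ sr].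
have : s `^ eps <= r `^ eps by rewrite ge0_ler_powR ?nnegrE // ltW.
rewrite /r -powRrM mulVf ?gt_eqF // powRr1; last by rewrite ltW // divr_gt0.
move=> h.
rewrite (le_trans (_ : _ <= (v + 1) * s `^ eps)) //.
  by rewrite ler_wpM2r ?powR_ge0 // lerDl.
by rewrite -ler_pdivlMl // mulrC.
Qed.

End Complex.

Section ComplexMean.
Context (R : realType) (disp : measure_display) (T : measurableType disp)
  (P : probability T R).
Implicit Types (Z : T -> R[i]).

Definition cess_bounded Z :=
  ess_bounded P (fun w => complex.Re (Z w)) /\ ess_bounded P (fun w => complex.Im (Z w)).

Lemma cexpectationE Z : cexpectation P Z =
  Complex (mean P (fun w => complex.Re (Z w))) (mean P (fun w => complex.Im (Z w))).
Proof. by []. Qed.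

Lemma cess_boundedW Z M : measurable_fun setT (fun w => complex.Re (Z w)) ->
  measurable_fun setT (fun w => complex.Im (Z w)) ->
  (forall w, cabs (Z w) <= M) -> cess_bounded Z.
Proof.
move=> mr mi h; split; apply: (@ess_boundedW _ _ _ _ _ M) => // w.
  exact: le_trans (normr_Re_le _) (h w).
exact: le_trans (normr_Im_le _) (h w).
Qed.

Lemma ess_bounded_sqr_cabs Z : cess_bounded Z ->
  ess_bounded P (fun w => cabs (Z w) ^+ 2).
Proof.
move=> [br bi]; under eq_fun do rewrite sqr_cabs !expr2.
by apply: ess_boundedD; exact: ess_boundedM.
Qed.

Lemma ess_bounded_cabs Z : cess_bounded Z -> ess_bounded P (fun w => cabs (Z w)).
Proof.
move=> bZ; have [[mr [M hM]] [mi [N hN]]] := bZ.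
have [ms _] := ess_bounded_sqr_cabs bZ; split.
  under eq_fun do rewrite -[cabs _]ger0_norm ?cabs_ge0 // -sqrtr_sqr.
  apply: (measurableT_comp (f := @Num.sqrt R)) ms.
  by apply: continuous_measurable_fun; exact: sqrt_continuous.
exists (M + N); apply: filterS2 hM hN => w h1 h2.
rewrite ger0_norm ?cabs_ge0 // (le_trans _ (lerD h1 h2)) //.
rewrite -(@ler_pXn2r _ 2) ?nnegrE ?cabs_ge0 ?addr_ge0 // sqr_cabs sqrrD.
rewrite !real_normK ?num_real //.
have : 0 <= `|complex.Re (Z w)| * `|complex.Im (Z w)| *+ 2 by rewrite mulrn_wge0 // mulr_ge0.
by lra.
Qed.

Lemma cess_bounded_cst c : cess_bounded (fun=> c).
Proof. by split; exact: ess_bounded_cst. Qed.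

Lemma cess_boundedB Z1 Z2 : cess_bounded Z1 -> cess_bounded Z2 ->
  cess_bounded (fun w => Z1 w - Z2 w).
Proof.
move=> [r1 i1] [r2 i2]; split.
  rewrite (_ : (fun _ => _) = fun w => complex.Re (Z1 w) - complex.Re (Z2 w)).
    exact: ess_boundedB.
  by apply/funext => w; case: (Z1 w) => a b; case: (Z2 w).
rewrite (_ : (fun _ => _) = fun w => complex.Im (Z1 w) - complex.Im (Z2 w)).
  exact: ess_boundedB.
by apply/funext => w; case: (Z1 w) => a b; case: (Z2 w).
Qed.

Lemma cexpectationB Z1 Z2 : cess_bounded Z1 -> cess_bounded Z2 ->
  cexpectation P (fun w => Z1 w - Z2 w) = cexpectation P Z1 - cexpectation P Z2.
Proof.
move=> [r1 i1] [r2 i2]; rewrite !cexpectationE.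
transitivity (Complex (mean P (fun w => complex.Re (Z1 w) - complex.Re (Z2 w)))
                      (mean P (fun w => complex.Im (Z1 w) - complex.Im (Z2 w)))).
  by congr Complex; apply: eq_mean => w; case: (Z1 w) => a b; case: (Z2 w).
by rewrite !meanB.
Qed.

Lemma eq_cexpectation Z1 Z2 : (forall w, Z1 w = Z2 w) ->
  cexpectation P Z1 = cexpectation P Z2.
Proof. by move=> h; congr cexpectation; apply/funext. Qed.

Lemma cexpectation_cst c : cexpectation P (fun=> c) = c.
Proof. by rewrite cexpectationE !mean_cst; case: c. Qed.

Lemma cexpectationZ c Z : cess_bounded Z ->
  cexpectation P (fun w => c * Z w) = c * cexpectation P Z.
Proof.
move=> [br bi]; rewrite !cexpectationE; case: c => a b.
transitivity (Complex
    (mean P (fun w => a * complex.Re (Z w) - b * complex.Im (Z w)))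
    (mean P (fun w => a * complex.Im (Z w) + b * complex.Re (Z w)))).
  by congr Complex; apply: eq_mean => w; case: (Z w).
rewrite meanB ?meanD ?meanZ //; try exact: ess_boundedZ.
Qed.

(** Since real and imaginary parts are averaged separately, the inequality is obtained by pairing
    with the mean [y]: [|y|^2] is the mean of the real part of [conj y * Z], which is at most
    [|y| |Z|]. *)
Lemma cabs_cexpectation Z : cess_bounded Z ->
  cabs (cexpectation P Z) <= mean P (fun w => cabs (Z w)).
Proof.
move=> bZ; have [br bi] := bZ; set y := cexpectation P Z.
have bc := ess_bounded_cabs bZ.
have m0 : 0 <= mean P (fun w => cabs (Z w)).
  by apply: mean_ge0 => //; apply: aeW => w; exact: cabs_ge0.
have [->|y0] := eqVneq (cabs y) 0; first by [].
have y1 : 0 < cabs y by rewrite lt_def y0 cabs_ge0.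
rewrite -(ler_pM2l y1) -meanZ // -expr2 sqr_cabs.
have -> : complex.Re y ^+ 2 + complex.Im y ^+ 2
  = mean P (fun w => complex.Re y * complex.Re (Z w) + complex.Im y * complex.Im (Z w)).
  by rewrite meanD ?meanZ //; exact: ess_boundedZ.
apply: ler_mean.
- by apply: ess_boundedD; exact: ess_boundedZ.
- exact: ess_boundedZ.
apply: aeW => w; apply: le_trans (ler_norm _) _.
rewrite -(@ler_pXn2r _ 2) ?nnegrE ?mulr_ge0 ?cabs_ge0 // exprMn !sqr_cabs.
rewrite real_normK ?num_real //.
case: y {y0 y1} => a b; case: (Z w) => e f /=.
rewrite -subr_ge0.
have -> : (a ^+ 2 + b ^+ 2) * (e ^+ 2 + f ^+ 2) - (a * e + b * f) ^+ 2
        = (a * f - b * e) ^+ 2 by ring.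
exact: sqr_ge0.
Qed.

(** The variance is the mean of [|Z|^2] minus the squared modulus of the mean. Its use: a mean of
    modulus nearly 1 forces [Z] to be nearly constant. *)
Lemma mean_sqr_cabsB Z : cess_bounded Z -> {ae P, forall w, cabs (Z w) <= 1} ->
  mean P (fun w => cabs (Z w - cexpectation P Z) ^+ 2)
  <= 1 - cabs (cexpectation P Z) ^+ 2.
Proof.
move=> bZ hZ; have [br bi] := bZ; set y := cexpectation P Z.
have bs := ess_bounded_sqr_cabs bZ.
pose L w := complex.Re y * complex.Re (Z w) + complex.Im y * complex.Im (Z w).
have bL : ess_bounded P L by apply: ess_boundedD; exact: ess_boundedZ.
have mL : mean P L = cabs y ^+ 2.
  by rewrite meanD ?meanZ ?sqr_cabs //; exact: ess_boundedZ.
rewrite (_ : mean P _ = mean P (fun w => (cabs (Z w) ^+ 2 - 2 * L w) + cabs y ^+ 2)); last first.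
  apply: eq_mean => w; rewrite !sqr_cabs /L; case: (Z w) => a b; case: (y) => e f /=.
  by ring.
have bL2 : ess_bounded P (fun w => 2 * L w) by exact: ess_boundedZ.
rewrite meanD //; last 2 first.
- exact: ess_boundedB.
- exact: ess_bounded_cst.
rewrite meanB // meanZ // mL mean_cst.
have : mean P (fun w => cabs (Z w) ^+ 2) <= 1.
  apply: mean_le_cst => //; apply: filterS hZ => w h.
  by rewrite expr_le1 // cabs_ge0.
by lra.
Qed.

End ComplexMean.

Section BorelFunctions.
Context (R : realType) (d : nat).
Implicit Types (p q : projspace R d) (u v : 'cV[R]_d).

Local Notation M := (mx_borel R d).

Lemma measurable_mulmx_entry v (i : 'I_d) :
  measurable_fun setT (fun a : M => ((a : 'M[R]_d) *m v) i 0).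
Proof.
rewrite (_ : (fun _ => _) = fun a : M => \sum_j (a : 'M[R]_d) i j * v j 0); last first.
  by apply/funext => a; rewrite mxE.
apply: measurable_sum => k.
by apply: measurable_funM => //; exact: measurable_coord.
Qed.

Lemma measurable_sqrt : measurable_fun setT (@Num.sqrt R).
Proof. by apply: continuous_measurable_fun; exact: sqrt_continuous. Qed.

Lemma measurable_dotp u v :
  measurable_fun setT (fun a : M => dotp ((a : 'M[R]_d) *m u) ((a : 'M[R]_d) *m v)).
Proof.
by apply: measurable_sum => i; apply: measurable_funM; exact: measurable_mulmx_entry.
Qed.

Lemma measurable_dotpr u v :
  measurable_fun setT (fun a : M => dotp ((a : 'M[R]_d) *m u) v).
Proof.
apply: measurable_sum => i; apply: measurable_funM => //.
exact: measurable_mulmx_entry.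
Qed.

Lemma measurable_enorm u :
  measurable_fun setT (fun a : M => enorm ((a : 'M[R]_d) *m u)).
Proof.
rewrite (_ : (fun _ => _) = fun a : M =>
    Num.sqrt (dotp ((a : 'M[R]_d) *m u) ((a : 'M[R]_d) *m u))); last first.
  by apply/funext => a; rewrite enormE.
exact: measurableT_comp measurable_sqrt (measurable_dotp _ _).
Qed.

Lemma measurable_invr_ge0 disp (S : measurableType disp) (f : S -> R) :
  (forall x, 0 <= f x) -> measurable_fun setT f ->
  measurable_fun setT (fun x => (f x)^-1).
Proof.
move=> f0 mf; rewrite (_ : (fun _ => _) = fun x => f x `^ (-1)); last first.
  by apply/funext => x; rewrite powR_inv1.
exact: measurableT_comp (measurable_powR _) mf.
Qed.

Lemma measurable_cocycle p : measurable_fun setT (fun a : M => cocycle a p).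
Proof.
apply: measurableT_comp; first exact: measurable_ln.
by apply: measurable_funM => //; exact: measurable_enorm.
Qed.

Lemma measurable_pdist2 u v : measurable_fun setT (fun a : M =>
  wedge_norm ((a : 'M[R]_d) *m u) ((a : 'M[R]_d) *m v) /
  (enorm ((a : 'M[R]_d) *m u) * enorm ((a : 'M[R]_d) *m v))).
Proof.
apply: measurable_funM; last first.
  apply: measurable_invr_ge0; first by move=> x; rewrite mulr_ge0 ?enorm_ge0.
  by apply: measurable_funM; exact: measurable_enorm.
rewrite (_ : (fun _ => _) = fun a : M => Num.sqrt
    (dotp ((a : 'M[R]_d) *m u) ((a : 'M[R]_d) *m u) *
     dotp ((a : 'M[R]_d) *m v) ((a : 'M[R]_d) *m v) -
     dotp ((a : 'M[R]_d) *m u) ((a : 'M[R]_d) *m v) ^+ 2)); last first.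
  by apply/funext => a; rewrite wedge_normE.
apply: measurableT_comp; first exact: measurable_sqrt.
apply: measurable_funB; first by apply: measurable_funM; exact: measurable_dotp.
by apply: measurable_funX; exact: measurable_dotp.
Qed.

Lemma measurable_pdist1 u v : measurable_fun setT (fun a : M =>
  wedge_norm ((a : 'M[R]_d) *m u) v / (enorm ((a : 'M[R]_d) *m u) * enorm v)).
Proof.
apply: measurable_funM; last first.
  apply: measurable_invr_ge0; first by move=> x; rewrite mulr_ge0 ?enorm_ge0.
  by apply: measurable_funM => //; exact: measurable_enorm.
rewrite (_ : (fun _ => _) = fun a : M => Num.sqrt
    (dotp ((a : 'M[R]_d) *m u) ((a : 'M[R]_d) *m u) * dotp v v -
     dotp ((a : 'M[R]_d) *m u) v ^+ 2)); last first.
  by apply/funext => a; rewrite wedge_normE.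
apply: measurableT_comp; first exact: measurable_sqrt.
apply: measurable_funB.
  by apply: measurable_funM => //; exact: measurable_dotp.
by apply: measurable_funX; exact: measurable_dotpr.
Qed.

Lemma val_pact_neq0 (a : 'M[R]_d) p : a *m repr_vec p != 0 ->
  val (pact a p) = <[a *m repr_vec p]>%VS.
Proof.
move=> a0; rewrite /pact val_insubd val_repr_vec limg_line lfunE /= dim_vline.
by rewrite a0 eqxx.
Qed.

(** The default value of [pact] matters because Borel functions are considered on all matrices,
    singular ones included. *)
Lemma pact_eq0 (a : 'M[R]_d) p : a *m repr_vec p = 0 -> pact a p = p.
Proof.
move=> a0; apply: val_inj; rewrite /= /pact val_insubd.
by rewrite {1 2}val_repr_vec limg_line lfunE /= a0 dim_vline eqxx.
Qed.

Lemma nbhs_mulmx (a : 'M[R]_d) u r : 0 < r ->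
  nbhs a [set b : 'M[R]_d | enorm ((b - a) *m u) < r].
Proof.
move=> r0; pose S := \sum_j `|u j 0|.
have S0 : 0 <= S by exact: sumr_ge0.
have c0 : 0 < d%:R * S + 1 by rewrite ltr_wpDl // mulr_ge0.
apply/nbhs_ballP; exists (r / (d%:R * S + 1)); first by rewrite /= divr_gt0.
move=> b [_ hb] /=; set e := r / _ in hb.
have e0 : 0 < e by rewrite divr_gt0.
have entry i : `|((b - a) *m u) i 0| <= e * S.
  rewrite mxE (le_trans (ler_norm_sum _ _ _)) // mulr_sumr ler_sum // => j _.
  rewrite normrM ler_wpM2r // !mxE distrC ltW //.
  exact: hb.
have := enorm_le_sum ((b - a) *m u).
move=> /le_lt_trans; apply; apply: (@le_lt_trans _ _ (\sum_(i < d) e * S)).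
  by apply: ler_sum => i _; exact: entry.
rewrite sumr_const card_ord -[_ *+ d]mulr_natl mulrCA /e mulrAC ltr_pdivrMr //.
by rewrite ltr_pM2l // ltrDl.
Qed.

(** [projspace] is given no sigma-algebra, so measurability is shown on matrices: where [a] does not
    kill [p], the function is continuous and its strict superlevel sets are open; on the remaining
    Borel set it has the constant value [h p]. *)
Lemma measurable_Holder_pact (h : projspace R d -> R) (v eps : R) p :
  0 <= v -> 0 < eps -> (forall x y, `|h x - h y| <= v * pdist x y `^ eps) ->
  measurable_fun setT (fun a : M => h (pact a p)).
Proof.
move=> v0 eps0 hh; set u := repr_vec p; have u0 := repr_vec_neq0 p.
apply: (measurability _ (RGenOInfty.measurableE R)) => _ [_ [c ->] <-]; rewrite setTI.
have mz : measurable [set a : M | enorm ((a : 'M[R]_d) *m u) == 0].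
  rewrite -[X in measurable X]setTI.
  apply: (@measurable_fun_eqr _ _ _ _ (fun a : M => enorm ((a : 'M[R]_d) *m u)) (fun=> 0) _ _ measurableT [set true]) => //.
  exact: measurable_enorm.
pose F (a : 'M[R]_d) := h (pact a p).
pose U := [set a : 'M[R]_d | a *m u != 0 /\ c < F a].
have oU : open U.
  rewrite openE => a [au ca].
  have eta0 : 0 < (F a - c) / 2 by rewrite divr_gt0 // subr_gt0.
  have [dl [dl0 dl1 hdl]] := powR_small v0 eta0 eps0.
  have au0 : 0 < enorm (a *m u) by rewrite enorm_gt0.
  (* The factor [1 / 2] keeps [b *m u] longer than half of [a *m u]; the projective distance of the
     two images is then at most [r / enorm (b *m u)], hence at most [dl]. *)
  pose r := dl * enorm (a *m u) / 2.
  have r0 : 0 < r by rewrite !mulr_gt0.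
  apply: filterS (nbhs_mulmx a u r0) => b /= hb.
  have bau : b *m u = a *m u + (b - a) *m u by rewrite mulmxBl addrC subrK.
  have ab : enorm (a *m u) <= enorm (b *m u) + enorm ((b - a) *m u).
    have -> : a *m u = b *m u - (b - a) *m u by rewrite bau addrK.
    by rewrite (le_trans (enormD _ _)) // -scaleN1r enormZ normrN1 mul1r.
  have rle : r <= enorm (a *m u) / 2.
    by rewrite /r -mulrA ler_piMl // divr_ge0 // ltW.
  have bu0 : enorm (a *m u) / 2 < enorm (b *m u) by lra.
  have bu : b *m u != 0.
    by rewrite -enorm_eq0 gt_eqF // (le_lt_trans _ bu0) // divr_ge0 // ltW.
  split => //.
  have ed : pdist (pact a p) (pact b p) <= dl.
    rewrite (pdistE au bu) ?val_pact_neq0 // ler_pdivrMr ?mulr_gt0 ?enorm_gt0 //.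
    have -> : wedge_norm (a *m u) (b *m u) = wedge_norm (a *m u) ((b - a) *m u).
      by rewrite -[RHS](wedge_norm_shear _ _ 1) scale1r addrC -bau.
    rewrite (le_trans (wedge_norm_le _ _)) // mulrCA ler_wpM2l ?enorm_ge0 //.
    rewrite (le_trans (ltW hb)) // /r -mulrA ler_wpM2l // ltW //.
  have := hdl _ (pdist_ge0 _ _) ed; have := hh (pact a p) (pact b p).
  rewrite -/(F a) -/(F b) ler_norml => /andP[_ h1] h2.
  have h3 : F a - F b <= (F a - c) / 2 by exact: le_trans h1 h2.
  by lra.
have mU : measurable (U : set M) by exact: sub_sigma_algebra.
have -> : (fun a : M => h (pact a p)) @^-1` `]c, +oo[%classic
    = U `|` ([set a : M | enorm ((a : 'M[R]_d) *m u) == 0] `&`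
             (if c < h p then setT else set0)).
  apply/seteqP; split => a; rewrite /= in_itv /= andbT.
    move=> ca; have [au|au] := eqVneq ((a : 'M[R]_d) *m u) 0.
      by right; rewrite enorm_eq0 au eqxx; rewrite pact_eq0 // in ca; rewrite ca.
    by left.
  move=> [[] //|[]]; rewrite enorm_eq0 => /eqP au; case: ifPn => // ch _.
  by rewrite pact_eq0.
by apply: measurableU => //; apply: measurableI => //; case: ifP.
Qed.

End BorelFunctions.

(** * Transfer operators *)

Section Transfer.
Context (R : realType) (d : nat) (disp : measure_display)
  (T : measurableType disp) (P : probability T R) (A : nat -> T -> 'M[R]_d).
Hypothesis hGL : forall j, (0 < j)%N -> random_GL (A j).
Hypothesis hI : independent_seq P A.
Implicit Types (g : projspace R d -> R[i]) (p q : projspace R d) (a b : 'M[R]_d).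

(** The sup bound and the Hoelder bound are kept apart, since the operators contract the second at
    the expense of the first and a different argument decreases the first. *)
Definition holder (eps s v : R) g :=
  (forall p, cabs (g p) <= s) /\
  (forall p q, cabs (g p - g q) <= v * pdist p q `^ eps).

Lemma holderW eps s v s' v' g : s <= s' -> v <= v' -> holder eps s v g ->
  holder eps s' v' g.
Proof.
move=> ss vv [h1 h2]; split=> [p|p q]; first exact: le_trans (h1 p) ss.
by rewrite (le_trans (h2 p q)) // ler_wpM2r ?powR_ge0.
Qed.

Lemma holderZ eps s v (c : R) g : 0 <= c -> holder eps s v g ->
  holder eps (c * s) (c * v) (fun p => Complex c 0 * g p).
Proof.
move=> c0 [h1 h2].
have ec : cabs (Complex c 0) = c by rewrite cabsE /= expr0n addr0 sqrtr_sqr ger0_norm.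
split=> [p|p q]; first by rewrite cabsM ec ler_wpM2l.
by rewrite -mulrBr cabsM ec -mulrA ler_wpM2l.
Qed.

Definition twist (t : R) g p a : R[i] := expi (t * cocycle a p) * g (pact a p).

Lemma cabs_twist t g p a : cabs (twist t g p a) = cabs (g (pact a p)).
Proof. by rewrite cabsM cabs_expi mul1r. Qed.

Lemma twistM t g p a b : a \in unitmx -> b \in unitmx ->
  twist t g p (b *m a) = expi (t * cocycle a p) * twist t g (pact a p) b.
Proof.
by move=> ua ub; rewrite /twist cocycleM // pactM // addrC mulrDr expiD mulrA.
Qed.

Lemma twist1 t g p : twist t g p 1%:M = g p.
Proof.
rewrite /twist pact1 /cocycle mul1mx divff ?enorm_eq0 ?repr_vec_neq0 //.
by rewrite ln1 mulr0 expi0 mul1r.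
Qed.

Lemma measurable_twist t g p (eps s v : R) : 0 < eps -> 0 <= v -> holder eps s v g ->
  measurable_fun setT (fun a : mx_borel R d => complex.Re (twist t g p a)) /\
  measurable_fun setT (fun a : mx_borel R d => complex.Im (twist t g p a)).
Proof.
move=> eps0 v0 [_ hg].
have mr : measurable_fun setT (fun a : mx_borel R d => complex.Re (g (pact a p))).
  apply: (@measurable_Holder_pact _ _ (fun x => complex.Re (g x)) v eps) => // x y.
  rewrite (le_trans _ (hg x y)) // (le_trans _ (normr_Re_le _)) //.
  by case: (g x) => ? ?; case: (g y).
have mi : measurable_fun setT (fun a : mx_borel R d => complex.Im (g (pact a p))).
  apply: (@measurable_Holder_pact _ _ (fun x => complex.Im (g x)) v eps) => // x y.
  rewrite (le_trans _ (hg x y)) // (le_trans _ (normr_Im_le _)) //.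
  by case: (g x) => ? ?; case: (g y).
have mt : measurable_fun setT (fun a : mx_borel R d => t * cocycle a p).
  by apply: measurable_funM => //; exact: measurable_cocycle.
have mc : measurable_fun setT (fun a : mx_borel R d => cos (t * cocycle a p)).
  apply: (measurableT_comp (f := @cos R)) mt.
  by apply: continuous_measurable_fun; exact: continuous_cos.
have ms : measurable_fun setT (fun a : mx_borel R d => sin (t * cocycle a p)).
  apply: (measurableT_comp (f := @sin R)) mt.
  by apply: continuous_measurable_fun; exact: continuous_sin.
split.
  rewrite (_ : (fun _ => _) = fun a : mx_borel R d =>
    cos (t * cocycle a p) * complex.Re (g (pact a p))
    - sin (t * cocycle a p) * complex.Im (g (pact a p))); last first.
    by apply/funext => a; rewrite /twist; case: (g _).
  by apply: measurable_funB; exact: measurable_funM.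
rewrite (_ : (fun _ => _) = fun a : mx_borel R d =>
    cos (t * cocycle a p) * complex.Im (g (pact a p))
    + sin (t * cocycle a p) * complex.Re (g (pact a p))); last first.
  by apply/funext => a; rewrite /twist; case: (g _).
by apply: measurable_funD; exact: measurable_funM.
Qed.

Lemma cess_bounded_twist t g p (eps s v : R) (X : T -> mx_borel R d) :
  0 < eps -> 0 <= v -> holder eps s v g -> measurable_fun setT X ->
  cess_bounded P (fun w => twist t g p (X w)).
Proof.
move=> eps0 v0 hg mX; have [mr mi] := measurable_twist t p eps0 v0 hg.
apply: (@cess_boundedW _ _ _ _ _ s).
- exact: measurableT_comp mr mX.
- exact: measurableT_comp mi mX.
by move=> w; rewrite cabs_twist; exact: hg.1.
Qed.

(** The cocycle identity [twistM] pulls the phase of [A j] out of the inner mean, and independence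
    merges the mean over [A j] and the mean over the later factors into one. *)
Lemma transfer_iterE t j n g p (eps s v : R) : (0 < j)%N -> 0 < eps -> 0 <= v ->
  holder eps s v g ->
  transfer_iter P A t j n g p
  = cexpectation P (fun w => twist t g p (mxprod A j n w)).
Proof.
move=> j0 eps0 v0 hg; elim: n j j0 p => [|n ih] j j0 p.
  by rewrite /= -[LHS](cexpectation_cst P) /=; apply: eq_cexpectation => w; rewrite twist1.
rewrite -[LHS]/(transfer P A t j (transfer_iter P A t j.+1 n g) p) /transfer.
have mA := measurable_mxprod hGL n (ltn0Sn j).
have cb p' := cess_bounded_twist t p' eps0 v0 hg mA.
transitivity (cexpectation P (fun w => cexpectation P (fun w' =>
    twist t g p (mxprod A j.+1 n w' *m A j w)))).
  apply: eq_cexpectation => w; rewrite ih // -cexpectationZ //.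
  by apply: eq_cexpectation => w'; rewrite twistM ?(hGL j0).1 // mxprod_unit.
have [mr mi] := measurable_twist t p eps0 v0 hg.
have hs a : cabs (twist t g p a) <= s by rewrite cabs_twist; exact: hg.1.
have [_ er] := mean_mxprodD hGL hI 1 n j0 mr
  (fun a => le_trans (normr_Re_le _) (hs a)).
have [_ ei] := mean_mxprodD hGL hI 1 n j0 mi
  (fun a => le_trans (normr_Im_le _) (hs a)).
rewrite !cexpectationE.
(* [mean_mxprodD] was used with a first block of length 1, hence the form [1 + n]. *)
rewrite -add1n.
by congr Complex; rewrite ?er ?ei; apply: eq_mean => w; rewrite mxprod1 addn1.
Qed.

End Transfer.

(** * Contraction on average *)

Section OperatorNorm.
Context (R : realType) (d : nat).
Implicit Types (a : 'M[R]_d) (x : 'cV[R]_d).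

Lemma normr_coord_le x i : `|x i 0| <= enorm x.
Proof.
rewrite -(@ler_pXn2r _ 2) ?nnegrE ?enorm_ge0 // sqr_enorm real_normK ?num_real //.
rewrite /dotp (bigD1 i) //= -expr2 lerDl; apply: sumr_ge0 => j _.
by rewrite -expr2 sqr_ge0.
Qed.

Lemma opnorm_ge a x : enorm (a *m x) <= opnorm a * enorm x.
Proof.
have [->|x0] := eqVneq x 0.
  have z : enorm (0 : 'cV[R]_d) = 0 by apply/eqP; rewrite enorm_eq0.
  by rewrite mulmx0 z mulr0.
have e0 := enorm_gt0 x0.
rewrite -ler_pdivrMr //.
have -> : enorm (a *m x) / enorm x = enorm (a *m ((enorm x)^-1 *: x)).
  by rewrite -scalemxAr enormZ ger0_norm ?invr_ge0 ?enorm_ge0 // mulrC.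
apply: ub_le_sup; last by exists ((enorm x)^-1 *: x); rewrite //= enorm_normalize.
exists (\sum_(i < d) \sum_(j < d) `|a i j|) => _ [y /= y1 <-].
rewrite (le_trans (enorm_le_sum _)) // ler_sum // => i _.
rewrite mxE (le_trans (ler_norm_sum _ _ _)) // ler_sum // => j _.
by rewrite normrM ler_piMr // -y1 normr_coord_le.
Qed.

Lemma quasi_isometry_max_norm (K : R) a : a \in unitmx -> max_norm a <= K ->
  quasi_isometry K a.
Proof.
move=> ua; rewrite /max_norm ge_max => /andP[h1 h2] x; split.
  by rewrite (le_trans (opnorm_ge _ _)) // ler_wpM2r ?enorm_ge0.
rewrite -{1}(mulKmx ua x) (le_trans (opnorm_ge _ _)) //.
by rewrite ler_wpM2r ?enorm_ge0.
Qed.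

(** From [expR (- x / 2) >= 1 - x / 2 > 0] one gets [expR x <= (1 - x / 2) ^- 2], and the rest is
    polynomial. No lower bound on [x] enters. *)
Lemma expR_le_sqr (x : R) : x <= 3^-1 -> expR x <= 1 + x + x ^+ 2.
Proof.
move=> x3; have h1 := expR_ge1Dx (- (x / 2)).
have c0 : 0 < 1 - x / 2 by lra.
have e0 : 0 < expR (- (x / 2)) by exact: expR_gt0.
have e1 : expR x * expR (- (x / 2)) ^+ 2 = 1.
  by rewrite expr2 -!expRD (_ : x + _ = 0) ?expR0 //; lra.
have h2 : 1 <= (1 + x + x ^+ 2) * (1 - x / 2) ^+ 2.
  rewrite -subr_ge0.
  have -> : (1 + x + x ^+ 2) * (1 - x / 2) ^+ 2 - 1
    = (x / 2) ^+ 2 * (1 - 3 * x + x ^+ 2) by field.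
  by rewrite mulr_ge0 ?sqr_ge0 // addr_ge0 ?sqr_ge0 //; lra.
have h3 : (1 - x / 2) ^+ 2 <= expR (- (x / 2)) ^+ 2.
  by rewrite ler_pXn2r ?nnegrE // ltW.
have p0 : 0 <= 1 + x + x ^+ 2 by nra.
rewrite -(ler_pM2r (exprn_gt0 2 e0)) e1 (le_trans h2) //.
by rewrite ler_wpM2l.
Qed.

End OperatorNorm.

Section Contraction.
Context (R : realType) (d : nat) (disp : measure_display)
  (T : measurableType disp) (P : probability T R) (A : nat -> T -> 'M[R]_d).
Hypothesis hGL : forall j, (0 < j)%N -> random_GL (A j).
Hypothesis hI : independent_seq P A.
Implicit Types (g : projspace R d -> R[i]) (p q : projspace R d) (a b : 'M[R]_d).

Lemma uniformly_bounded_quasi_isometry : uniformly_bounded P A ->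
  exists K : R, 1 <= K /\
    forall j, (0 < j)%N -> {ae P, forall w, quasi_isometry K (A j w)}.
Proof.
move=> [K hK]; exists (Num.max 1 K); split; first by rewrite le_max lexx.
move=> j j0; apply: filterS (hK j j0) => w h.
apply: quasi_isometry_max_norm; first exact: (hGL j0).1.
by rewrite le_max h orbT.
Qed.

Lemma ae_quasi_isometry_mxprod (K : R) : 1 <= K ->
  (forall j, (0 < j)%N -> {ae P, forall w, quasi_isometry K (A j w)}) ->
  forall j n, (0 < j)%N -> {ae P, forall w, quasi_isometry (K ^+ n) (mxprod A j n w)}.
Proof.
move=> K1 hK j n j0; have K0 : 0 <= K by exact: le_trans K1.
elim: n => [|n ih]; first by apply: aeW => w; exact: quasi_isometry1.
have jn0 : (0 < j + n)%N by rewrite addn_gt0 j0.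
apply: filterS2 (hK _ jn0) ih => w h1 h2.
by rewrite exprS; apply: quasi_isometryM => //; exact: exprn_ge0.
Qed.

(* A Borel function on all matrices, equal to [move_dist] below on invertible ones;
   [pdist (pact a p) (pact a q)] has other values where [a] kills [p] or [q]. *)
Definition image_dist (eps : R) p q (a : mx_borel R d) : R :=
  (wedge_norm ((a : 'M[R]_d) *m repr_vec p) ((a : 'M[R]_d) *m repr_vec q) /
   (enorm ((a : 'M[R]_d) *m repr_vec p) * enorm ((a : 'M[R]_d) *m repr_vec q))) `^ eps.

Lemma image_distE eps p q a : a \in unitmx ->
  image_dist eps p q a = pdist (pact a p) (pact a q) `^ eps.
Proof.
move=> ua; have [p0 q0] := (repr_vec_neq0 p, repr_vec_neq0 q).
by rewrite (@pdistE _ _ _ _ (a *m repr_vec p) (a *m repr_vec q))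
  ?mulmx_unit_neq0 ?val_pact.
Qed.

Lemma powR_le1 (x eps : R) : 0 <= eps -> 0 <= x -> x <= 1 -> x `^ eps <= 1.
Proof.
move=> e0 x0 x1; have -> : 1 = 1 `^ eps by rewrite powR1.
by apply: ge0_ler_powR; rewrite ?nnegrE.
Qed.

Lemma normr_image_dist eps p q a : 0 <= eps -> `|image_dist eps p q a| <= 1.
Proof.
move=> e0; rewrite ger0_norm ?powR_ge0 //; apply: powR_le1 => //.
  by rewrite divr_ge0 ?wedge_norm_ge0 // mulr_ge0 ?enorm_ge0.
have [->|h] := eqVneq (enorm (a *m repr_vec p) * enorm (a *m repr_vec q)) 0.
  by rewrite invr0 mulr0.
rewrite ler_pdivrMr ?mul1r ?wedge_norm_le //.
by rewrite lt_def h mulr_ge0 ?enorm_ge0.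
Qed.

Lemma measurable_image_dist eps p q : measurable_fun setT (image_dist eps p q).
Proof. exact: measurableT_comp (measurable_powR _) (measurable_pdist2 _ _). Qed.

Definition move_dist (eps : R) j n p q w :=
  pdist (pact (mxprod A j n w) p) (pact (mxprod A j n w) q) `^ eps.

Lemma ess_bounded_move_dist eps j n p q : (0 < j)%N -> 0 <= eps ->
  ess_bounded P (move_dist eps j n p q).
Proof.
move=> j0 e0; rewrite (_ : move_dist _ _ _ _ _ =
    fun w => image_dist eps p q (mxprod A j n w)); last first.
  by apply/funext => w; rewrite image_distE // mxprod_unit.
apply: (@ess_boundedW _ _ _ _ _ 1); last by move=> w; exact: normr_image_dist.
exact: measurableT_comp (measurable_image_dist _ _ _) (measurable_mxprod hGL n j0).
Qed.

Definition contracts (eps : R) n (c : R) := forall j p q, (0 < j)%N ->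
  mean P (move_dist eps j n p q) <= c * pdist p q `^ eps.

Lemma contractsD eps n m c c' : 0 <= eps -> 0 <= c' ->
  contracts eps n c -> contracts eps m c' -> contracts eps (n + m) (c * c').
Proof.
move=> e0 c0 hn hm j p q j0; have jn0 : (0 < j + n)%N by rewrite addn_gt0 j0.
have [b er] := mean_mxprodD hGL hI n m j0 (measurable_image_dist eps p q)
  (fun a => normr_image_dist p q a e0).
rewrite (_ : mean P _ = mean P (fun w => image_dist eps p q (mxprod A j (n + m) w))); last first.
  by apply: eq_mean => w; rewrite image_distE // mxprod_unit.
rewrite er mulrAC.
apply: (@le_trans _ _ (mean P (fun w => c' * move_dist eps j n p q w))).
  apply: ler_mean => //; first by apply: ess_boundedZ; exact: ess_bounded_move_dist.
  apply: aeW => w; apply: le_trans (hm (j + n)%N _ _ jn0).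
  rewrite le_eqVlt; apply/orP; left; apply/eqP; apply: eq_mean => w'.
  have ua := mxprod_unit hGL n w j0; have ub := mxprod_unit hGL m w' jn0.
  rewrite image_distE; last by rewrite unitmx_mul ub ua.
  by rewrite /move_dist (pactM p ua ub) (pactM q ua ub).
rewrite meanZ; last exact: ess_bounded_move_dist.
by rewrite mulrC ler_wpM2r // hn.
Qed.

Lemma contracts_mul eps n c : 0 <= eps -> 0 <= c -> contracts eps n c ->
  forall m, contracts eps (n * m) (c ^+ m).
Proof.
move=> e0 c0 h; elim=> [|m ih].
  move=> j p q j0; rewrite muln0 mul1r mean_le_cst //.
    exact: ess_bounded_move_dist.
  apply: aeW => w; rewrite /move_dist /=.
  by rewrite !pact1.
by rewrite mulnS exprS; apply: contractsD => //; exact: exprn_ge0.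
Qed.

(** If [l] is the logarithm of the ratio of the distances, the [eps]-th power of the ratio is
    [expR (eps * l)], at most [1 + eps l + eps^2 l^2]. The linear term has mean at most
    [- eps * dl], and since [l] is bounded it wins for small [eps]. *)
Lemma log_contracting_contracts (K : R) : 1 <= K ->
  (forall j, (0 < j)%N -> {ae P, forall w, quasi_isometry K (A j w)}) ->
  log_contracting P A ->
  exists (n0 : nat) (eps0 : R), [/\ (0 < n0)%N, 0 < eps0 <= 1 &
    forall eps, 0 < eps <= eps0 -> exists c, [/\ 0 < c, c < 1 & contracts eps n0 c]].
Proof.
move=> K1 hK [n0 [dl [n00 [dl0 hlog]]]].
pose L := (K ^+ n0) ^+ 4; have L1 : 1 <= L by rewrite !exprn_ege1.
have L0 : 0 < L by exact: lt_le_trans L1.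
(* [L] bounds the distortion of distances by [n0] factors, so [B] bounds [|l|]; the summand 1 keeps
   it positive when [K = 1]. *)
pose B := ln L + 1; have B0 : 0 < B by rewrite ltr_wpDl // ln_ge0.
(* The bound [1 / (3 B)] gives [eps * l <= 1 / 3] for [expR_le_sqr]; the last one makes the
   quadratic term at most half of [eps * dl]. *)
exists n0, (Num.min (Num.min 1 (3 * B)^-1) (dl / (2 * B ^+ 2))); split => //.
  apply/andP; split; last by rewrite ge_min ge_min lexx.
  rewrite !lt_min ltr01 invr_gt0 mulr_gt0 //= divr_gt0 // mulr_gt0 //.
  exact: exprn_gt0.
move=> eps /andP[eps0]; rewrite !le_min => /andP[/andP[_ e1] e2].
have eB : eps * B <= 3^-1.
  by move: e1; rewrite invfM -ler_pdivlMr // => /le_trans -> //; rewrite mulrC.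
have eB2 : eps * B ^+ 2 <= dl / 2.
  move: e2; rewrite ler_pdivlMr ?mulr_gt0 ?exprn_gt0 //; lra.
(* The maximum with [1 / 2] serves only to ensure [0 < c]. *)
exists (Num.max 2^-1 (1 - eps * dl / 2)); split.
- by rewrite lt_max invr_gt0 ltr0n.
- by rewrite gt_max; apply/andP; split; [lra|rewrite ltrBlDr ltrDl divr_gt0 // mulr_gt0].
move=> j p q j0; have [<-|/eqP pq] := eqVneq p q.
  have -> : mean P (move_dist eps j n0 p p) = mean P (fun=> 0).
    by apply: eq_mean => w; rewrite /move_dist pdistxx powR0 // gt_eqF.
  by rewrite mean_cst pdistxx powR0 ?mulr0 // gt_eqF.
have d0 := pdist_gt0 pq.
pose l w := ln (pdist (pact (mxprod A j n0 w) p) (pact (mxprod A j n0 w) q) / pdist p q).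
have hq := ae_quasi_isometry_mxprod K1 hK n0 j0.
have lB : {ae P, forall w, `|l w| <= B /\
    move_dist eps j n0 p q w = expR (eps * l w) * pdist p q `^ eps}.
  apply: filterS hq => w hw; have Kn0 : 0 <= K ^+ n0 by rewrite exprn_ge0 // (le_trans _ K1).
  have uw := mxprod_unit hGL n0 w j0.
  have h1 := pdist_pact p q Kn0 uw hw.
  have h2 := pdist_pact_ge p q Kn0 uw hw.
  have D0 : 0 < pdist (pact (mxprod A j n0 w) p) (pact (mxprod A j n0 w) q).
    by rewrite -(pmulr_rgt0 _ L0) (lt_le_trans d0).
  rewrite /move_dist /l.
  move: (pdist (pact _ _) _) (pdist p q) h1 h2 D0 d0 => D e h1 h2 D0 e0.
  have r0 : 0 < D / e by rewrite divr_gt0.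
  split; last first.
    rewrite -{1}(divfK (lt0r_neq0 e0) D) powRM ?(ltW r0) ?(ltW e0) //; congr (_ * _).
    by rewrite /powR gt_eqF.
  have lL : ln (D / e) <= ln L by rewrite ler_ln ?posrE // ler_pdivrMr.
  have lL' : - ln L <= ln (D / e).
    by rewrite -lnV ?posrE // ler_ln ?posrE ?invr_gt0 // ler_pdivlMr // mulrC ler_pdivrMr // mulrC.
  by rewrite /B ler_norml; lra.
have bl : ess_bounded P l.
  split; last by exists B; apply: filterS lB => w [].
  rewrite (_ : l = fun w => ln (image_dist 1 p q (mxprod A j n0 w) / pdist p q)); last first.
    apply/funext => w; rewrite image_distE ?mxprod_unit // powRr1 //.
    exact: pdist_ge0.
  apply: measurableT_comp; first exact: measurable_ln.
  apply: measurable_funM => //.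
  exact: measurableT_comp (measurable_image_dist _ _ _) (measurable_mxprod hGL n0 j0).
have ml : mean P l <= - dl.
  rewrite -lee_fin fineK; last first.
    by rewrite unlock; apply: integrable_fin_num => //; exact: ess_bounded_integrable.
  apply: le_trans hlog; apply: le_ereal_sup_tmp.
  eexists; first by exists j.
  by apply: ereal_sup_ubound; exists (p, q).
have ele : mean P (move_dist eps j n0 p q) <=
    mean P (fun w => pdist p q `^ eps * (1 + eps ^+ 2 * B ^+ 2 + eps * l w)).
  apply: ler_mean; first by apply: ess_bounded_move_dist => //; exact: ltW.
    apply: ess_boundedZ; apply: ess_boundedD; first exact: ess_bounded_cst.
    exact: ess_boundedZ.
  apply: filterS lB => w [lw ->]; rewrite mulrC ler_wpM2l ?powR_ge0 //.
  have x3 : eps * l w <= 3^-1.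
    rewrite (le_trans _ eB) // ler_wpM2l ?(ltW eps0) //.
    exact: le_trans (ler_norm _) lw.
  rewrite (le_trans (expR_le_sqr x3)) // addrAC lerD2r lerD2l exprMn.
  rewrite ler_wpM2l ?sqr_ge0 // -[leLHS]real_normK ?num_real //.
  by rewrite ler_pXn2r ?nnegrE // ltW.
rewrite (le_trans ele) // meanZ; last first.
  apply: ess_boundedD; first exact: ess_bounded_cst.
  exact: ess_boundedZ.
rewrite meanD; last 2 first.
- exact: ess_bounded_cst.
- exact: ess_boundedZ.
rewrite mean_cst meanZ // mulrC ler_wpM2r ?powR_ge0 // le_max; apply/orP; right.
have := ler_wpM2l (ltW eps0) ml; have := ler_wpM2l (ltW eps0) eB2.
rewrite mulrA -expr2; move: (mean P l) => m.
by lra.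
Qed.

End Contraction.

(** * The Lasota-Yorke inequality *)

Section LasotaYorke.
Context (R : realType) (d : nat) (disp : measure_display)
  (T : measurableType disp) (P : probability T R) (A : nat -> T -> 'M[R]_d).
Hypothesis hGL : forall j, (0 < j)%N -> random_GL (A j).
Hypothesis hI : independent_seq P A.
Variable K : R.
Hypothesis K1 : 1 <= K.
Hypothesis hK : forall j, (0 < j)%N -> {ae P, forall w, quasi_isometry K (A j w)}.
Implicit Types (g : projspace R d -> R[i]) (p q : projspace R d) (a b : 'M[R]_d).

Lemma transfer_iterD t j n m g :
  transfer_iter P A t j (n + m) g
  = transfer_iter P A t j n (transfer_iter P A t (j + n) m g).
Proof.
by elim: n j => [|n ih] j; rewrite ?addn0 // addSn /= ih addSnnS.
Qed.

Lemma transfer_iterZ (t : R) j n g (eps s v c : R) : (0 < j)%N ->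
  0 < eps -> 0 <= v -> 0 <= c -> holder eps s v g ->
  transfer_iter P A t j n (fun p => Complex c 0 * g p)
  = fun p => Complex c 0 * transfer_iter P A t j n g p.
Proof.
move=> j0 e0 v0 c0 hg; apply/funext => p.
rewrite (transfer_iterE hGL hI t n p j0 e0 v0 hg).
rewrite (transfer_iterE hGL hI t n p j0 e0 (mulr_ge0 c0 v0) (holderZ c0 hg)).
rewrite -cexpectationZ; last first.
  exact: (cess_bounded_twist P t p e0 v0 hg (measurable_mxprod hGL n j0)).
by apply: eq_cexpectation => w; rewrite /twist mulrCA.
Qed.

(** A crude expansion bound for any number of factors, for stretches whose length is not a multiple
    of [n0]. *)
Lemma contracts_trivial (eps : R) n : 0 < eps <= 1 -> contracts P A eps n (K ^+ n ^+ 4).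
Proof.
move=> /andP[e0 e1] j p q j0; have Kn1 : 1 <= K ^+ n by rewrite exprn_ege1.
have Kn0 : 0 <= K ^+ n by exact: le_trans Kn1.
apply: mean_le_cst; first by apply: ess_bounded_move_dist => //; exact: ltW.
apply: filterS (ae_quasi_isometry_mxprod K1 hK n j0) => w hw.
have uw := mxprod_unit hGL n w j0.
have := pdist_pact p q Kn0 uw hw; rewrite /move_dist.
have : 1 <= K ^+ n ^+ 4 by exact: exprn_ege1.
move: (K ^+ n ^+ 4) => L L1 h; have L0 : 0 <= L by exact: le_trans L1.
apply: (@le_trans _ _ ((L * pdist p q) `^ eps)).
  apply: ge0_ler_powR; [exact: ltW|by rewrite nnegrE pdist_ge0| |exact: h].
  by rewrite nnegrE mulr_ge0 ?pdist_ge0.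
rewrite powRM ?pdist_ge0 // ler_wpM2r ?powR_ge0 //.
by rewrite ler1_powR.
Qed.

(** The difference of two twists splits into a difference of phases, Lipschitz with constant at most
    [2 T0 (K ^+ n) ^+ 2], and a difference of values of [g], which [contracts] controls on average.
    As [pdist <= 1], a Lipschitz bound is also an [eps]-Hoelder bound. *)
Lemma holder_transfer_iter (eps c T0 t s v : R) n j g : 0 < eps <= 1 ->
  0 <= s -> 0 <= v -> `|t| <= T0 -> (0 < j)%N -> contracts P A eps n c ->
  holder eps s v g ->
  holder eps s (c * v + 2 * T0 * (K ^+ n) ^+ 2 * s) (transfer_iter P A t j n g).
Proof.
move=> /andP[e0 e1] s0 v0 tT j0 hc hg.
have mX := measurable_mxprod hGL n j0.
have bt p := cess_bounded_twist P t p e0 v0 hg mX.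
have T00 : 0 <= T0 by exact: le_trans tT.
have Kn0 : 0 <= K ^+ n by rewrite exprn_ge0 // (le_trans _ K1).
split=> [p|p q]; rewrite !(transfer_iterE hGL hI t n _ j0 e0 v0 hg).
  apply: le_trans (cabs_cexpectation (bt p)) _; apply: mean_le_cst.
    exact: ess_bounded_cabs.
  by apply: aeW => w; rewrite cabs_twist; exact: hg.1.
rewrite -cexpectationB //.
apply: le_trans (cabs_cexpectation (cess_boundedB (bt p) (bt q))) _.
have bm : ess_bounded P (move_dist A eps j n p q).
  by apply: ess_bounded_move_dist => //; exact: ltW.
apply: (@le_trans _ _ (mean P (fun w => v * move_dist A eps j n p q w +
    2 * T0 * (K ^+ n) ^+ 2 * s * pdist p q `^ eps))); last first.
  rewrite meanD; [|exact: ess_boundedZ|exact: ess_bounded_cst].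
  rewrite mean_cst meanZ // (mulrDl (c * v)) lerD2r (mulrC c) -mulrA ler_wpM2l //.
  exact: hc.
apply: ler_mean.
- exact: ess_bounded_cabs (cess_boundedB (bt p) (bt q)).
- by apply: ess_boundedD; [exact: ess_boundedZ|exact: ess_bounded_cst].
apply: filterS (ae_quasi_isometry_mxprod K1 hK n j0) => w hw.
rewrite /move_dist /twist.
move: (mxprod A j n w) hw => a ha.
have -> : expi (t * cocycle a p) * g (pact a p) - expi (t * cocycle a q) * g (pact a q)
  = (expi (t * cocycle a p) - expi (t * cocycle a q)) * g (pact a p)
    + expi (t * cocycle a q) * (g (pact a p) - g (pact a q)) by ring.
rewrite (le_trans (cabsD _ _)) // addrC !cabsM cabs_expi mul1r.
apply: lerD; first exact: hg.2.
have h1 := cabs_expiB (t * cocycle a p) (t * cocycle a q).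
have h2 := cocycle_Lipschitz p q Kn0 ha.
rewrite -mulrBr normrM in h1.
have h3 : pdist p q <= pdist p q `^ eps.
  have [->|/eqP pq] := eqVneq p q; first by rewrite pdistxx powR_ge0.
  by rewrite ger1_powR // pdist_gt0 //= pdist_le1.
have h4 : cabs (expi (t * cocycle a p) - expi (t * cocycle a q))
    <= T0 * (2 * (K ^+ n) ^+ 2 * pdist p q `^ eps).
  apply: le_trans h1 _; apply: ler_pM => //; apply: le_trans h2 _.
  by rewrite ler_wpM2l // mulr_ge0 // sqr_ge0.
apply: (@le_trans _ _ (T0 * (2 * (K ^+ n) ^+ 2 * pdist p q `^ eps) * s)).
  by apply: ler_pM; rewrite ?cabs_ge0 //; exact: hg.1.
by rewrite le_eqVlt; apply/orP; left; apply/eqP; ring.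
Qed.

(** The sup norm coefficient is the fixed point of [b -> c b + 2 T0 (K ^+ n) ^+ 2], so it does not
    grow with the number of rounds. *)
Lemma holder_transfer_iter_mul (eps c T0 t s v : R) n m j g : 0 < eps <= 1 ->
  0 <= c -> c < 1 ->
  0 <= s -> 0 <= v -> `|t| <= T0 -> (0 < j)%N -> contracts P A eps n c ->
  holder eps s v g ->
  holder eps s (c ^+ m * v + 2 * T0 * (K ^+ n) ^+ 2 / (1 - c) * s)
    (transfer_iter P A t j (n * m) g).
Proof.
move=> he c0 c1 s0 v0 tT j0 hc hg; set B := _ / _.
have T00 : 0 <= T0 by exact: le_trans tT.
have Kn0 : 0 <= K ^+ n by rewrite exprn_ge0 // (le_trans _ K1).
have c1' : 0 < 1 - c by rewrite subr_gt0.
have B0 : 0 <= B by rewrite divr_ge0 ?(ltW c1') // !mulr_ge0.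
elim: m j j0 => [|m ih] j j0.
  by rewrite muln0 /= mul1r; apply: holderW hg => //; rewrite lerDl mulr_ge0.
rewrite mulnS transfer_iterD.
have jn0 : (0 < j + n)%N by rewrite addn_gt0 j0.
have := holder_transfer_iter he s0 _ tT j0 hc (ih _ jn0).
have -> : c * (c ^+ m * v + B * s) + 2 * T0 * (K ^+ n) ^+ 2 * s
  = c ^+ m.+1 * v + B * s.
  have -> : 2 * T0 * (K ^+ n) ^+ 2 = B * (1 - c) by rewrite divfK // gt_eqF.
  by rewrite exprS; ring.
by apply; rewrite addr_ge0 // mulr_ge0 // exprn_ge0.
Qed.

End LasotaYorke.

(** * Phases along a pencil of vectors *)

Section Pencil.
Context (R : realType) (n : nat).
Implicit Types (p r e : 'cV[R]_n).

Lemma ln_ratio_le (x y c : R) : 0 < x -> 0 < y -> 0 <= c -> x <= y * (1 + c) ->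
  ln x - ln y <= c.
Proof.
move=> x0 y0 c0 h; rewrite -ln_div ?posrE //.
rewrite (le_trans (_ : _ <= ln (1 + c))) ?le_ln1Dx //; last first.
  by rewrite (lt_le_trans _ c0) // ltrN10.
rewrite ler_ln ?posrE ?divr_gt0 //; last by rewrite ltr_pwDl.
by rewrite ler_pdivrMr // mulrC.
Qed.

Lemma ln_ratio_dist (x y c : R) : 0 < x -> 0 < y -> 0 <= c ->
  x <= y * (1 + c) -> y <= x * (1 + c) -> `|ln x - ln y| <= c.
Proof.
move=> x0 y0 c0 h1 h2; rewrite ler_norml lerNl opprB.
by rewrite !ln_ratio_le.
Qed.

(* The image [p + s r] of the pencil almost vanishes at
   [s0 = - <p, r> / |r|^2] and is close to [(s - s0) r] away from it: at the
   distances [tau rho] and [tau rho E] from [s0] the images are almost collinear,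
   but the logarithms of their norms differ by about [ln E]. *)
Lemma pencil e1 e2 p r (tau E0 E K1 h : R) :
  dotp e1 e1 = 1 -> dotp e2 e2 = 1 -> dotp e1 e2 = 0 ->
  0 < tau -> 1 <= E -> E <= E0 -> 8 * tau * E0 <= 1 -> 1 <= K1 ->
  0 < enorm r -> enorm p <= K1 * enorm r -> enorm r <= K1 * enorm p ->
  0 < h -> h * K1 <= tau ^+ 2 ->
  wedge_norm p r <= tau ^+ 2 * (enorm p * enorm r) ->
  exists z1 z2 : R, [/\ `|z1| <= 2 * K1, `|z2| <= 2 * K1 &
   forall s1 s2, z1 <= s1 <= z1 + h -> z2 <= s2 <= z2 + h ->
    let x1 := e1 + s1 *: e2 in let x2 := e1 + s2 *: e2 in
    let y1 := p + s1 *: r in let y2 := p + s2 *: r in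
    [/\ wedge_norm x1 x2 <= 8 * tau * E0 * (enorm x1 * enorm x2),
        wedge_norm y1 y2 <= tau * (enorm y1 * enorm y2) &
        `|ln (enorm y1) - ln (enorm x1) - (ln (enorm y2) - ln (enorm x2)) - ln E|
          <= 12 * tau * E0]].
Proof.
move=> d11 d22 d12 tau0 E1 EE0 tE K11 r0 pr rp h0 hK hw.
have rr : dotp r r = enorm r ^+ 2 by rewrite sqr_enorm.
have rr0 : 0 < dotp r r by rewrite rr exprn_gt0.
(* The norm of [p + s r] is smallest at [s0], where it equals [m] times the norm of [r]; elsewhere
   it is given by Pythagoras, see [normy]. *)
pose rho := enorm p / enorm r; pose s0 := - (dotp p r / dotp r r).
pose m := wedge_norm p r / dotp r r.
have rhoK : rho <= K1 by rewrite ler_pdivrMr.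
have rhoK' : 1 <= rho * K1 by rewrite /rho mulrAC ler_pdivlMr // mul1r mulrC.
have K0 : 0 < K1 by exact: lt_le_trans K11.
have rho0 : 0 < rho by rewrite -(pmulr_lgt0 _ K0) (lt_le_trans ltr01).
have m0 : 0 <= m by rewrite divr_ge0 ?wedge_norm_ge0 // ltW.
have mrho : m <= tau ^+ 2 * rho.
  rewrite ler_pdivrMr // rr (le_trans hw) // le_eqVlt; apply/orP; left; apply/eqP.
  by rewrite /rho; field; rewrite gt_eqF.
have sm : s0 ^+ 2 + m ^+ 2 = rho ^+ 2.
  rewrite /s0 /m /rho sqrrN !expr_div_n sqr_wedge_norm (sqr_enorm p) rr.
  by field; rewrite gt_eqF.
have normy s : enorm (p + s *: r) = enorm r * Num.sqrt ((s - s0) ^+ 2 + m ^+ 2).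
  apply/eqP; rewrite -(@eqrXn2 _ 2) ?enorm_ge0 ?mulr_ge0 ?sqrtr_ge0 ?enorm_ge0 //.
  rewrite exprMn (sqr_enorm (p + _)) -rr sqr_sqrtr ?addr_ge0 ?sqr_ge0 //.
  rewrite !dotpE (dotpC r p).
  have pp : dotp p p = dotp r r * rho ^+ 2.
    by rewrite /rho expr_div_n (sqr_enorm p) rr; field; rewrite gt_eqF.
  have dpr : dotp p r = - (s0 * dotp r r) by rewrite mulNr opprK divfK // gt_eqF.
  by apply/eqP; rewrite pp dpr -sm; ring.
have lowy s : 0 <= s - s0 -> enorm r * (s - s0) <= enorm (p + s *: r).
  move=> u0; rewrite normy ler_wpM2l ?enorm_ge0 //.
  by rewrite -[leLHS]ger0_norm // -sqrtr_sqr ler_sqrt ?addr_ge0 ?sqr_ge0 // lerDl sqr_ge0.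
have uppy s : 0 <= s - s0 -> enorm (p + s *: r) <= enorm r * (s - s0 + m).
  move=> u0; rewrite normy ler_wpM2l ?enorm_ge0 //.
  have u1 : 0 <= s - s0 + m by rewrite addr_ge0.
  have um : 0 <= (s - s0) * m by exact: mulr_ge0.
  rewrite -(@ler_pXn2r _ 2) ?nnegrE ?sqrtr_ge0 //.
  rewrite sqr_sqrtr; last by rewrite addr_ge0 ?sqr_ge0.
  by move: (s - s0) um => u um; nra.
have normx s : enorm (e1 + s *: e2) = Num.sqrt (1 + s ^+ 2).
  rewrite enormE !dotpE d11 d22 (dotpC e2 e1) d12; congr Num.sqrt; ring.
have x1 s : 1 <= enorm (e1 + s *: e2).
  by rewrite normx -[leLHS]sqrtr1 ler_sqrt ?addr_ge0 ?sqr_ge0 // lerDl sqr_ge0.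
have xs s : `|s| <= enorm (e1 + s *: e2).
  by rewrite normx -sqrtr_sqr ler_sqrt ?addr_ge0 ?sqr_ge0 // lerDr.
have dx s t : enorm (e1 + s *: e2) <= enorm (e1 + t *: e2) + `|s - t|.
  have -> : e1 + s *: e2 = (e1 + t *: e2) + (s - t) *: e2.
    by rewrite -addrA -scalerDl addrC addrC subrKC.
  rewrite (le_trans (enormD _ _)) // lerD2l enormZ.
  have -> : enorm e2 = 1 by rewrite enormE d22 sqrtr1.
  by rewrite mulr1.
have wm : wedge_norm p r = m * enorm r ^+ 2.
  by rewrite /m rr divfK // gt_eqF ?exprn_gt0.
have we : wedge_norm e1 e2 = 1.
  by rewrite wedge_normE d11 d22 d12 expr0n subr0 mulr1 sqrtr1.
clearbody rho s0 m; clear hw pr rp rr rr0 normy normx.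
have e00 : 1 <= E0 by exact: le_trans EE0.
have tau8 : 8 * tau <= 1 by apply: le_trans tE; rewrite ler_peMr // mulr_ge0 // ltW.
have tr0 : 0 < tau * rho by exact: mulr_gt0.
have hr : h <= tau * (tau * rho).
  rewrite -(ler_pM2r K0) (le_trans hK) //.
  have -> : tau * (tau * rho) * K1 = tau ^+ 2 * (rho * K1) by ring.
  by rewrite ler_peMr ?sqr_ge0.
have mr : m <= tau * (tau * rho) by rewrite mulrA -expr2.
(* As [m] is tiny compared with [rho], nearly all of [rho] is in [s0]. Parameters near [s0] are thus
   of size comparable to [rho], so moving by a small fraction of [rho] hardly changes
   [e1 + s e2]. *)
have s0r : rho / 2 <= `|s0|.
  have mm : m <= rho / 2 by nra.
  rewrite -(@ler_pXn2r _ 2) ?nnegrE ?(ltW (divr_gt0 rho0 _)) //.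
  rewrite real_normK ?num_real //; nra.
have s0r' : `|s0| <= rho.
  rewrite -(@ler_pXn2r _ 2) ?nnegrE ?(ltW rho0) // real_normK ?num_real //.
  by rewrite -sm lerDl sqr_ge0.
have Er : tau * rho * E <= rho / 8.
  have : tau * E <= 1 / 8 by nra.
  by nra.
have E0' : 0 < E by exact: lt_le_trans E1.
have trE : tau * rho <= tau * rho * E by rewrite ler_peMr // ltW.
have pos F : 1 <= F -> F <= E -> `|s0 + tau * rho * F| <= 2 * K1.
  move=> F1 FE; have : tau * rho * F <= tau * rho * E by rewrite ler_pM2l.
  have F0 : 0 <= tau * rho * F by rewrite mulr_ge0 ?(ltW tr0) // (le_trans _ F1).
  move=> h1; rewrite (le_trans (ler_normD _ _)) // (ger0_norm F0); lra.
(* By [hr] the windows are shorter than their distance to [s0] by the factor [tau], so any points in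
   them behave like their left ends. *)
exists (s0 + tau * rho * E), (s0 + tau * rho); split.
- exact: pos.
- by rewrite -[tau * rho]mulr1; exact: pos.
move=> s1 s2 /andP[s1l s1u] /andP[s2l s2u] y1' y2' w1 w2.
rewrite {}/y1' {}/y2' {}/w1 {}/w2.
have [u1 eu1] : exists u, u = s1 - s0 by eexists.
have [u2 eu2] : exists u, u = s2 - s0 by eexists.
have u1l : tau * rho * E <= u1 by clear -s1l eu1; lra.
have u2l : tau * rho <= u2 by clear -s2l eu2; lra.
have u1u : u1 <= tau * rho * E * (1 + tau).
  have : tau * (tau * rho) <= tau * (tau * rho * E) by rewrite ler_pM2l.
  by clear -s1u eu1 hr; lra.
have u2u : u2 <= tau * rho * (1 + tau) by clear -s2u eu2 hr; lra.
have u20 : 0 < u2 by exact: lt_le_trans u2l.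
have u10 : 0 < u1 by apply: lt_le_trans u1l; exact: mulr_gt0.
rewrite eu1 eu2 in u10 u20.
have [Y1l Y2l] := (lowy s1 (ltW u10), lowy s2 (ltW u20)).
have [Y1u Y2u] := (uppy s1 (ltW u10), uppy s2 (ltW u20)).
rewrite -eu1 -eu2 in u10 u20 Y1l Y2l Y1u Y2u.
have X12 := dx s1 s2; have X21 := dx s2 s1; rewrite distrC in X21.
have [X1 X2] := (x1 s1, x1 s2).
have [S1 S2] := (xs s1, xs s2).
have es : s1 - s2 = u1 - u2 by rewrite eu1 eu2; ring.
have tE2 : tau * rho * E * (1 + tau) <= 2 * (tau * rho * E).
  rewrite mulrC ler_pM2r; last exact: mulr_gt0.
  by clear -tau8; lra.
have u2E : u2 <= tau * rho * E * (1 + tau).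
  apply: le_trans u2u _; rewrite ler_wpM2r //.
  by rewrite addr_ge0 // ltW.
have dS : `|s1 - s2| <= 2 * (tau * rho * E).
  by rewrite es ler_norml; clear -u1u u2E tE2 u10 u20; lra.
have lo s u : u = s - s0 -> 0 < u -> u <= rho / 4 -> rho / 4 <= `|s|.
  move=> us ug ul; have -> : s = s0 + u by rewrite us; ring.
  have := lerB_normD s0 u; rewrite (gtr0_norm ug); clear -s0r ul; lra.
have uE4 : tau * rho * E * (1 + tau) <= rho / 4 by clear -tE2 Er; lra.
have s1r : rho / 4 <= `|s1|.
  by apply: (lo _ u1) => //; exact: le_trans u1u uE4.
have s2r : rho / 4 <= `|s2|.
  by apply: (lo _ u2) => //; exact: le_trans u2E uE4.
clear lowy uppy x1 xs dx pos lo s1l s1u s2l s2u hr hK h0 d11 d22 d12 K11 rhoK rhoK' sm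
  tE2 uE4 s0r s0r' Er eu1 eu2.
move: Y1l Y2l Y1u Y2u X12 X21 X1 X2 S1 S2.
rewrite !wedge_norm_pencil.
rewrite we wm mulr1.
move: (enorm (p + s1 *: r)) (enorm (p + s2 *: r)) (enorm (e1 + s1 *: e2))
  (enorm (e1 + s2 *: e2)) => Y1 Y2 X1 X2 Y1l Y2l Y1u Y2u X12 X21 X1l X2l S1 S2.
split.
(* The parameters differ by at most [2 tau rho E], while the product of the norms is at least
   [rho / 4]: one factor is at least 1, the other at least [|s2|]. *)
- rewrite (le_trans dS) //.
  have h1 : rho / 4 <= X1 * X2.
    by rewrite -[leLHS]mul1r ler_pM // ?(le_trans s2r) // ltW // divr_gt0.
  have t0 : 0 <= 8 * tau * E0 by rewrite !mulr_ge0 // ?(ltW tau0) // (le_trans _ e00).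
  apply: le_trans (ler_wpM2l t0 h1).
  have -> : 8 * tau * E0 * (rho / 4) = 2 * (tau * rho * E0) by field.
  by rewrite ler_pM2l // ler_pM2l.
(* The difference is at most the larger of [u1], [u2], and [m <= tau * (tau * rho)] is at most [tau]
   times the smaller one. *)
- have h1 : `|u1 - u2| * m <= tau * (u1 * u2).
    have [u12|u21] := leP u1 u2.
      rewrite ler0_norm ?subr_le0 // (le_trans (_ : _ <= u2 * (tau * (tau * rho)))) //.
        by apply: ler_pM => //; [rewrite oppr_ge0 subr_le0|rewrite opprB; lra].
      rewrite mulrCA ler_pM2l // mulrC ler_pM2r //; lra.
    rewrite gtr0_norm ?subr_gt0 // (le_trans (_ : _ <= u1 * (tau * (tau * rho)))) //.
      by apply: ler_pM => //; [rewrite subr_ge0 ltW|lra].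
    by rewrite mulrCA ler_pM2l // ler_pM2l.
  have h2 : (enorm r * u1) * (enorm r * u2) <= Y1 * Y2.
    by rewrite ler_pM // mulr_ge0 // ltW.
  rewrite es; apply: le_trans (ler_wpM2l (ltW tau0) h2).
  have -> : tau * (enorm r * u1 * (enorm r * u2)) = tau * (u1 * u2) * enorm r ^+ 2 by ring.
  by rewrite [leLHS]mulrA ler_wpM2r ?sqr_ge0.
(* The images have norms about [b * E] and [b], each with logarithmic error [2 tau]; the points
   themselves add [8 tau E0], which makes at most [12 tau E0]. *)
pose b := enorm r * (tau * rho); have b0 : 0 < b by exact: mulr_gt0.
have t20 : 0 <= 2 * tau by rewrite mulr_ge0 // ltW.
have Y10 : 0 < Y1 by apply: lt_le_trans Y1l; exact: mulr_gt0.
have Y20 : 0 < Y2 by apply: lt_le_trans Y2l; exact: mulr_gt0.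
have c1 : `|ln Y1 - ln (b * E)| <= 2 * tau.
  apply: ln_ratio_dist => //; first exact: mulr_gt0.
    apply: le_trans Y1u _; rewrite /b -!mulrA ler_pM2l //.
    have : tau * (tau * rho) <= tau * (tau * rho * E) by rewrite ler_pM2l.
    by lra.
  apply: (@le_trans _ _ Y1); last by rewrite ler_peMr ?(ltW Y10) // lerDl.
  by apply: le_trans Y1l; rewrite /b -mulrA ler_pM2l.
have c2 : `|ln Y2 - ln b| <= 2 * tau.
  apply: ln_ratio_dist => //.
    by apply: le_trans Y2u _; rewrite /b -mulrA ler_pM2l //; lra.
  apply: (@le_trans _ _ Y2); last by rewrite ler_peMr ?(ltW Y20) // lerDl.
  by apply: le_trans Y2l; rewrite /b ler_pM2l.
have t80 : 0 <= 8 * tau * E0 by rewrite !mulr_ge0 // ?(ltW tau0) // (le_trans _ e00).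
have [X10 X20] : 0 < X1 /\ 0 < X2 by split; apply: lt_le_trans ltr01 _.
have dE : `|s1 - s2| <= 8 * tau * E0 * (rho / 4).
  rewrite (le_trans dS) //.
  have -> : 8 * tau * E0 * (rho / 4) = 2 * (tau * rho * E0) by field.
  by rewrite ler_pM2l // ler_pM2l.
have c3 : `|ln X1 - ln X2| <= 8 * tau * E0.
  apply: ln_ratio_dist => //.
    rewrite (le_trans X12) // mulrDr mulr1 lerD2l (le_trans dE) // mulrC ler_wpM2r //.
    exact: le_trans s2r _.
  rewrite (le_trans X21) // mulrDr mulr1 lerD2l (le_trans dE) // mulrC ler_wpM2r //.
  exact: le_trans s1r _.
have lnb : ln (b * E) = ln b + ln E by rewrite lnM ?posrE.
rewrite lnb in c1.
have te : tau <= tau * E0 by rewrite ler_peMr // ltW.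
move: c1 c2 c3 te; rewrite !ler_norml -!mulrA.
move: (tau * E0) (ln Y1) (ln Y2) (ln X1) (ln X2) (ln b) (ln E) => w a1 a2 a3 a4 a5 a6.
move=> /andP[? ?] /andP[? ?] /andP[? ?] ?; apply/andP; split; lra.
Qed.

End Pencil.

(** * Decay of the sup norm *)

Lemma expr_small (R : realType) (c eta : R) : 0 <= c -> c < 1 -> 0 < eta ->
  exists m : nat, c ^+ m <= eta.
Proof.
move=> c0 c1 eta0; have cn : `|c| < 1 by rewrite ger0_norm.
have /cvgrPdist_le /(_ eta eta0) [m _ h] := cvg_expr cn.
exists m; have := h m (leqnn m); rewrite /= sub0r normrN ger0_norm //.
exact: exprn_ge0.
Qed.

(** The bound on [k] does not involve [z]: finitely many fixed parameters meet every window,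
    although the windows depend on the random product. *)
Lemma grid_point (R : realType) (h B z : R) : 0 < h -> `|z| <= B ->
  exists k : nat, (k < (Num.truncn (2 * B / h)).+2)%N /\
    z <= k%:R * h - B <= z + h.
Proof.
move=> h0 zB; have [zl zu] : - B <= z /\ z <= B by apply/andP; rewrite -ler_norml.
pose y := (z + B) / h.
have y0 : 0 <= y by rewrite divr_ge0 ?(ltW h0) //; lra.
exists (Num.truncn y).+1; split.
  rewrite ltnS ltnS; apply: le_truncn; rewrite ler_pM2r ?invr_gt0 //; lra.
have hy : y * h = z + B by rewrite divfK // gt_eqF.
have h1 : y < (Num.truncn y).+1%:R by exact: truncnS_gt.
have h2 : (Num.truncn y)%:R <= y by rewrite truncn_le.
move: h1; rewrite -natr1 => h1.
move: (Num.truncn y)%:R h1 h2 => k h1 h2.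
apply/andP; split.
  have : y * h <= (k + 1) * h by rewrite ler_pM2r // ltW.
  by rewrite hy; lra.
have : k * h <= y * h by rewrite ler_pM2r.
by rewrite hy; lra.
Qed.

(* The pencil contains two nearby points with nearby images under [a] at which the
   phases of the twist are almost opposite, whereas both twists are close to [y]. *)
Lemma pencil_gap (R : realType) (d : nat) (eps V T0 tau E0 Kn h t : R) (a : 'M[R]_d)
    (g y : projspace R d -> R[i]) (e1 e2 : 'cV[R]_d)
    (x0 : forall s, e1 + s *: e2 != 0) :
  dotp e1 e1 = 1 -> dotp e2 e2 = 1 -> dotp e1 e2 = 0 ->
  0 < tau -> 1 <= E0 -> 8 * tau * E0 <= 1 -> T0 * (12 * tau * E0) <= 8^-1 ->
  0 < `|t| -> `|t| <= T0 -> expR (pi / `|t|) <= E0 ->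
  (forall s, 0 <= s -> s <= 8 * tau * E0 -> V * s `^ eps <= 8^-1) ->
  1 <= Kn -> a \in unitmx -> quasi_isometry Kn a ->
  wedge_norm (a *m e1) (a *m e2)
    <= tau ^+ 2 * (enorm (a *m e1) * enorm (a *m e2)) ->
  0 < h -> h * Kn ^+ 2 <= tau ^+ 2 ->
  holder eps 1 V g -> holder eps 1 V y ->
  (forall z, `|z| <= 2 * Kn ^+ 2 -> exists s, z <= s <= z + h /\
    cabs (twist t g (proj_line (x0 s)) a - y (proj_line (x0 s))) <= 8^-1) ->
  exists s, cabs (y (proj_line (x0 s))) <= 2^-1.
Proof.
move=> d11 d22 d12 tau0 E01 tE tT t0 tT0 EE hV Kn1 ua ha hw h0 hK hg hy hgrid.
have E0p : 0 < E0 by exact: lt_le_trans E01.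
have E1 : 1 <= expR (pi / `|t|).
  by rewrite -[leLHS]expR0 ler_expR divr_ge0 ?pi_ge0.
have n1 : enorm e1 = 1 by rewrite enormE d11 sqrtr1.
have n2 : enorm e2 = 1 by rewrite enormE d22 sqrtr1.
have Kn0 : 0 <= Kn by exact: le_trans Kn1.
have [a1 a1'] := ha e1; have [a2 a2'] := ha e2.
rewrite n1 mulr1 in a1 a1'; rewrite n2 mulr1 in a2 a2'.
have r0 : 0 < enorm (a *m e2).
  rewrite lt_def enorm_ge0 andbT; apply/eqP => r0.
  by move: a2'; rewrite r0 mulr0 ler10.
have pr : enorm (a *m e1) <= Kn ^+ 2 * enorm (a *m e2).
  by rewrite (le_trans a1) // expr2 -mulrA ler_peMr.
have rp : enorm (a *m e2) <= Kn ^+ 2 * enorm (a *m e1).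
  by rewrite (le_trans a2) // expr2 -mulrA ler_peMr.
have Kn21 : 1 <= Kn ^+ 2 by exact: exprn_ege1.
(* Used with [E = expR (pi / |t|)], so that a change of [ln E] in the cocycle turns the phase by
   exactly [pi]; [Kn ^+ 2] bounds the ratio of the norms of the two images. *)
have [z1 [z2 [zK1 zK2 hz]]] := pencil d11 d22 d12 tau0 E1 EE tE Kn21 r0 pr rp h0 hK hw.
have [s1 [hs1 c1]] := hgrid _ zK1; have [s2 [hs2 c2]] := hgrid _ zK2.
have := hz s1 s2 hs1 hs2; rewrite /=.
rewrite !scalemxAr -!mulmxDr => -[h1 h2 h3] {hz}.
set P1 := proj_line (x0 s1) in c1 *; set P2 := proj_line (x0 s2) in c2 *.
have [v1 v2] : val P1 = <[e1 + s1 *: e2]>%VS /\ val P2 = <[e1 + s2 *: e2]>%VS by [].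
have av s : a *m (e1 + s *: e2) != 0 by exact: mulmx_unit_neq0.
have Q q (s : R) : val q = <[e1 + s *: e2]>%VS ->
    val (pact a q) = <[a *m (e1 + s *: e2)]>%VS.
  exact: val_pact_line.
have D12 : pdist P1 P2 <= 8 * tau * E0.
  rewrite (pdistE (x0 s1) (x0 s2) v1 v2) ler_pdivrMr //.
  by rewrite mulr_gt0 ?enorm_gt0.
have DQ : pdist (pact a P1) (pact a P2) <= 8 * tau * E0.
  rewrite (pdistE (av s1) (av s2) (Q _ _ v1) (Q _ _ v2)).
  apply: (@le_trans _ _ tau).
    by rewrite ler_pdivrMr // mulr_gt0 ?enorm_gt0.
  rewrite mulrAC ler_peMl ?(ltW tau0) // (le_trans E01) // ler_peMl ?(ltW E0p) //.
  by rewrite ler1n.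
have cE P s : val P = <[e1 + s *: e2]>%VS ->
    cocycle a P = ln (enorm (a *m (e1 + s *: e2))) - ln (enorm (e1 + s *: e2)).
  by move=> vP; rewrite (cocycleE a (x0 s) vP) ln_div ?posrE ?enorm_gt0.
rewrite -(cE P1 s1 v1) -(cE P2 s2 v2) expRK in h3.
have opp : cabs (expi (t * cocycle a P1) + expi (t * cocycle a P2)) <= 8^-1.
  have tpi : forall b : R, `|b| <= 12 * tau * E0 -> `|t * b| <= 8^-1.
    move=> b hb; rewrite normrM (le_trans _ tT) // ler_pM //.
  have [tp|tn] := ltP 0 t.
    rewrite -[expi (t * cocycle a P2)]opprK -expiDpi.
    rewrite (le_trans (cabs_expiB _ _)) //.
    apply: le_trans (tpi _ h3); rewrite (gtr0_norm tp).
    rewrite (_ : t * (_ - _ - _) = t * cocycle a P1 - (t * cocycle a P2 + pi)) //.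
    by field; rewrite gt_eqF.
  have tn0 : t < 0 by rewrite lt_neqAle tn andbT -normr_gt0.
  rewrite addrC -[expi (t * cocycle a P1)]opprK -expiDpi.
  rewrite (le_trans (cabs_expiB _ _)) //.
  apply: le_trans (tpi _ h3); rewrite (ltr0_norm tn0).
  rewrite (_ : t * (_ - _ - _) = - (t * cocycle a P2 - (t * cocycle a P1 + pi))).
    by rewrite normrN.
  by field; rewrite lt_eqF.
have y12 : cabs (y P1 - y P2) <= 8^-1.
  exact: le_trans (hy.2 _ _) (hV _ (pdist_ge0 _ _) D12).
have g12 : cabs (g (pact a P1) - g (pact a P2)) <= 8^-1.
  exact: le_trans (hg.2 _ _) (hV _ (pdist_ge0 _ _) DQ).
exists s1; rewrite -/P1.
(* Five error terms, each of modulus at most [1 / 8]: continuity of [y], the two twists, the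
   opposite phases and continuity of [g]. *)
have e : y P1 *+ 2 = (y P1 - y P2) - (twist t g P1 a - y P1) - (twist t g P2 a - y P2)
    + (expi (t * cocycle a P1) + expi (t * cocycle a P2)) * g (pact a P1)
    - expi (t * cocycle a P2) * (g (pact a P1) - g (pact a P2)).
  by rewrite /twist; ring.
have : cabs (y P1 *+ 2) <= 8^-1 + 8^-1 + 8^-1 + 8^-1 + 8^-1.
  rewrite e; apply: le_trans (cabsD _ _) _; apply: lerD; last first.
    by rewrite cabsN cabsM cabs_expi mul1r.
  apply: le_trans (cabsD _ _) _; apply: lerD; last first.
    rewrite cabsM -[leRHS]mulr1 ler_pM ?cabs_ge0 //; exact: hg.1.
  apply: le_trans (cabsD _ _) _; apply: lerD; last by rewrite cabsN.
  apply: le_trans (cabsD _ _) _; apply: lerD; last by rewrite cabsN.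
  exact: y12.
rewrite (_ : cabs _ = cabs (y P1) *+ 2); last exact: normcMn.
by rewrite mulr2n; move: (cabs _) => b; lra.
Qed.

Section Gap.
Context (R : realType) (d : nat) (disp : measure_display)
  (T : measurableType disp) (P : probability T R) (A : nat -> T -> 'M[R]_d).
Hypothesis hGL : forall j, (0 < j)%N -> random_GL (A j).
Hypothesis hI : independent_seq P A.
Variable K : R.
Hypothesis K1 : 1 <= K.
Hypothesis hK : forall j, (0 < j)%N -> {ae P, forall w, quasi_isometry K (A j w)}.
Implicit Types (g : projspace R d -> R[i]) (p q : projspace R d) (a b : 'M[R]_d).

Lemma regular_hitting (delta : R) : regular_distributions P A -> 0 < delta ->
  exists (k : nat) (r : R), 0 < r /\ forall j p q, (0 < j)%N ->
   (r%:E <= P [set w | (pdist (pact (mxprod A j k w) p) q <= delta)%R])%E.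
Proof.
move=> hreg dl0; have [_ [k [_]]] := hreg _ dl0.
set e := ereal_inf _ => e0; exists k.
have [r [r0 re]] : exists r : R, 0 < r /\ (r%:E <= e)%E.
  (* The value [+oo] arises only if there are no lines at all; any positive [r] then serves. *)
  move: e e0 => [r r0|_|//]; first by exists r.
  by exists 1; rewrite ltr01 leey.
exists r; split=> // j p q j0; apply: le_trans re _.
apply: (@le_trans _ _ (ereal_inf [set P [set w | (pdist (pact (mxprod A j k w) xy.1) xy.2
      <= delta)%R] | xy in [set: projspace R d * projspace R d]])).
  by apply: ereal_inf_lbound; exists j.
by apply: ereal_inf_lbound; exists (p, q).
Qed.

(** Hoelder continuity spreads the gap at [q], halved, to a ball of fixed radius around [q], and [k]
    factors carry any line into this ball with probability at least [r]. The gap at one point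
    becomes a gap at all points. *)
Lemma transfer_iter_spread (eps V kappa : R) : regular_distributions P A ->
  0 < eps -> 0 <= V -> 0 < kappa ->
  exists (k : nat) (k2 : R), [/\ 0 < k2, k2 <= 2^-1 &
    forall j t h, (0 < j)%N -> holder eps 1 V h -> (exists q, cabs (h q) <= 1 - kappa) ->
    forall p, cabs (transfer_iter P A t j k h p) <= 1 - k2].
Proof.
move=> hreg e0 V0 k0; have k20 : 0 < kappa / 2 by rewrite divr_gt0.
have [dl [dl0 _ hdl]] := powR_small V0 k20 e0.
have [k [r [r0 hr]]] := regular_hitting hreg dl0.
exists k, (Num.min 2^-1 (kappa / 2 * r)); split.
- by rewrite lt_min invr_gt0 ltr0n mulr_gt0.
- by rewrite ge_min lexx.
move=> j t h j0 hh [q hq] p.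
rewrite (transfer_iterE hGL hI t k p j0 e0 V0 hh).
have mX := measurable_mxprod hGL k j0.
have bt := cess_bounded_twist P t p e0 V0 hh mX.
pose E := [set w | pdist (pact (mxprod A j k w) p) q <= dl].
have mE : measurable E.
  pose f (a : mx_borel R d) :=
    wedge_norm ((a : 'M[R]_d) *m repr_vec p) (repr_vec q) /
    (enorm ((a : 'M[R]_d) *m repr_vec p) * enorm (repr_vec q)).
  have mf : measurable_fun setT (fun w => f (mxprod A j k w)).
    exact: measurableT_comp (measurable_pdist1 _ _) mX.
  have -> : E = (fun w => f (mxprod A j k w) <= dl) @^-1` [set true].
    have fE w : f (mxprod A j k w) = pdist (pact (mxprod A j k w) p) q.
      have uw := mxprod_unit hGL k w j0.
      rewrite (@pdistE _ _ _ _ (mxprod A j k w *m repr_vec p) (repr_vec q)) //.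
      - exact: mulmx_unit_neq0 uw (repr_vec_neq0 p).
      - exact: repr_vec_neq0.
      - exact: val_pact.
      - exact: val_repr_vec.
    by apply/seteqP; split => w; rewrite /E /= fE.
  rewrite -[X in measurable X]setTI.
  exact: (measurable_fun_ler mf (measurable_cst dl)).
apply: le_trans (cabs_cexpectation bt) _.
apply: (@le_trans _ _ (mean P (fun w => 1 - kappa / 2 * \1_E w))).
  apply: ler_mean.
  - exact: ess_bounded_cabs.
  - apply: ess_boundedB; first exact: ess_bounded_cst.
    by apply: ess_boundedZ; exact: ess_bounded_indic.
  apply: aeW => w; rewrite cabs_twist indicE.
  have [/set_mem Ew|_] := boolP (w \in E); last by rewrite mulr0 subr0; exact: hh.1.
  have := hdl _ (pdist_ge0 _ _) Ew; have := hh.2 (pact (mxprod A j k w) p) q.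
  rewrite mulr1; have := cabsD (h (pact (mxprod A j k w) p) - h q) (h q).
  rewrite subrK; move: (cabs (h (pact _ p))) (cabs (_ - _)) (V * _) hq => x y z.
  by lra.
rewrite meanB; last 2 first.
- exact: ess_bounded_cst.
- by apply: ess_boundedZ; exact: ess_bounded_indic.
rewrite mean_cst meanZ; last exact: ess_bounded_indic.
rewrite mean_indic // lerD2l lerN2 ge_min; apply/orP; right.
rewrite ler_pM2l // -lee_fin fineK ?fin_num_measure //.
exact: hr.
Qed.

Lemma mean_sum_le (I : Type) (s : seq I) (f : I -> T -> R) (b B : R) :
  (forall i, ess_bounded P (f i)) -> (forall i, mean P (f i) <= b) ->
  (size s)%:R * b <= B -> mean P (fun w => \sum_(i <- s) f i w) <= B.
Proof.
move=> bf fb; apply: le_trans; rewrite mean_sum //.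
apply: le_trans (ler_sum _ (fun i _ => fb i)) _.
by rewrite big_const_seq count_predT iter_addr addr0 mulr_natl.
Qed.

(* If [|L^n g|] were almost 1 everywhere, the random variables
   [twist t g p (A_{j,n})] would almost be equal to their means [L^n g p],
   simultaneously for all [p] in a finite part of the pencil [e1 + s e2].  As some
   such product also brings the images of [e1] and [e2] together, this contradicts
   [pencil_gap]. *)
Lemma transfer_iter_gap (eps c V delta0 T0 : R) n0 : (2 <= d)%N -> 0 < eps <= 1 ->
  0 < c -> c < 1 -> contracts P A eps n0 c -> 0 <= V -> 0 < delta0 -> delta0 < T0 ->
  exists (m : nat) (kappa : R), [/\ 0 < kappa, c ^+ m <= 2^-1 &
    forall j t g, (0 < j)%N -> delta0 <= `|t| <= T0 -> holder eps 1 V g ->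
      holder eps 1 V (transfer_iter P A t j (n0 * m) g) ->
      exists p, cabs (transfer_iter P A t j (n0 * m) g p) <= 1 - kappa].
Proof.
move=> d2 /andP[e0 e1] c0 c1 hc V0 dl0 dT.
have T00 : 0 < T0 by exact: lt_trans dT.
(* The largest range of scales needed to turn the phase by [pi]; the lower bound on [|t|] makes it
   finite. *)
pose E0 : R := expR (pi / delta0).
have E01 : 1 <= E0.
  by rewrite -expR0 ler_expR divr_ge0 ?pi_ge0 // ltW.
have E00 : 0 < E0 by exact: lt_le_trans E01.
have e8 : 0 < 8^-1 :> R by rewrite invr_gt0 ltr0n.
have [dl [dlp dl1 hdl]] := powR_small V0 e8 e0.
(* The first bound keeps the Hoelder variation between the two points, and between their images,
   below [1 / 8]; the second does so for the phase error [T0 * (12 tau E0)]. *)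
pose tau := Num.min (dl / (8 * E0)) (96 * T0 * E0)^-1.
have E80 : 0 < 8 * E0 by rewrite mulr_gt0.
have TE0 : 0 < 96 * T0 * E0 by rewrite !mulr_gt0.
have tau0 : 0 < tau by rewrite lt_min divr_gt0 //= invr_gt0.
have tau1 : 8 * tau * E0 <= dl.
  have : tau <= dl / (8 * E0) by rewrite ge_min lexx.
  by rewrite ler_pdivlMr // mulrCA mulrA.
have tau2 : T0 * (12 * tau * E0) <= 8^-1.
  have : tau <= (96 * T0 * E0)^-1 by rewrite ge_min lexx orbT.
  rewrite -[(_)^-1]mul1r ler_pdivlMr // => h.
  have -> : T0 * (12 * tau * E0) = tau * (96 * T0 * E0) / 8 by field.
  by rewrite -[leRHS]mul1r ler_pM2r.
clearbody tau.
have tE1 : 8 * tau * E0 <= 1 by exact: le_trans dl1.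
have taudl : tau <= dl.
  apply: le_trans tau1; rewrite mulrAC ler_peMl ?(ltW tau0) //.
  by rewrite (le_trans E01) // ler_peMl ?(ltW E00) // ler1n.
have tau_1 : tau <= 1 by exact: le_trans dl1.
have eta0 : 0 < tau ^+ 2 by exact: exprn_gt0.
have ep0 : 0 < (tau ^+ 2) `^ eps by exact: powR_gt0.
have ep1 : (tau ^+ 2) `^ eps <= 1.
  by apply: powR_le1; rewrite ?(ltW e0) ?(ltW eta0) // expr_le1 // ltW.
(* Enough rounds for the mean of the [eps]-th power of the distance between two images to be at most
   a quarter of its value at distance [tau ^+ 2]. *)
have [m hm] := expr_small (ltW c0) c1 (divr_gt0 ep0 (ltr0n R 4)).
pose n := (n0 * m)%N.
have Kn1 : 1 <= K ^+ n by exact: exprn_ege1.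
pose K2 := (K ^+ n) ^+ 2.
have K21 : 1 <= K2 by exact: exprn_ege1.
have K20 : 0 < K2 by exact: lt_le_trans K21.
pose h := tau ^+ 2 / K2; have h0 : 0 < h by exact: divr_gt0.
pose N := (Num.truncn (2 * (2 * K2) / h)).+2.
(* If all means have modulus above [1 - kp], each variance is at most [2 kp]; weighted by 64 and
   summed over the [N] grid points they must stay below [1 / 4]. *)
have [kp [kp0 kp1 kpN]] : exists kp : R, [/\ 0 < kp, kp <= 8^-1 & N%:R * (128 * kp) <= 4^-1].
  have N1 : 1 <= N%:R :> R by rewrite ler1n.
  have N0 : 0 < N%:R :> R by rewrite ltr0n.
  move: (N%:R : R) N0 N1 => x x0 x1; have i0 : 0 < x^-1 by rewrite invr_gt0.
  have i1 : x^-1 <= 1 by rewrite invf_le1.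
  have xi : x * x^-1 = 1 by rewrite divff // gt_eqF.
  exists (x^-1 / 512); move: (x^-1) i0 i1 xi => i i0 i1 xi; split; lra.
exists m, kp; split => //.
  by apply: le_trans hm _; move: ep1; move: (_ `^ _) => y; lra.
move=> j t g j0 /andP[td tT] hg hLg; apply: contrapT => /forallNP hno.
have t0 : 0 < `|t| by exact: lt_le_trans td.
have big p : 1 - kp < cabs (transfer_iter P A t j (n0 * m) g p).
  by rewrite ltNge; apply/negP; exact: hno.
have i0 : (0 < d)%N by exact: leq_trans d2.
pose e1' : 'cV[R]_d := delta_mx (Ordinal i0) 0.
pose e2' : 'cV[R]_d := delta_mx (Ordinal d2) 0.
have dd (a b : 'I_d) : dotp (delta_mx a 0 : 'cV[R]_d) (delta_mx b 0) = (a == b)%:R.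
  rewrite /dotp (bigD1 a) //= big1 => [|i ia].
    by rewrite !mxE !eqxx !andbT mul1r addr0.
  by rewrite !mxE (negPf ia) mul0r.
have d11 : dotp e1' e1' = 1 by rewrite dd eqxx.
have d22 : dotp e2' e2' = 1 by rewrite dd eqxx.
have d12 : dotp e1' e2' = 0 by rewrite dd.
have e20 : e2' != 0.
  by rewrite -enorm_eq0 enormE d22 sqrtr1 oner_eq0.
have e10 : e1' != 0.
  by rewrite -enorm_eq0 enormE d11 sqrtr1 oner_eq0.
have x0 s : e1' + s *: e2' != 0.
  apply/negP => /eqP x0.
  have := dotpDl e1' (s *: e2') e1'; rewrite x0 dotpZl (dotpC e2') d12 d11.
  have -> : dotp 0 e1' = 0 by rewrite /dotp big1 // => i _; rewrite mxE mul0r.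
  by move=> /eqP; rewrite mulr0 addr0 eq_sym oner_eq0.
pose sk (k : nat) : R := k%:R * h - 2 * K2.
pose pk k := proj_line (x0 (sk k)).
pose p1 := proj_line e10; pose p2 := proj_line e20.
pose y p := transfer_iter P A t j n g p.
pose Z p w := twist t g p (mxprod A j n w).
have yE p : y p = cexpectation P (Z p) by exact: transfer_iterE e0 V0 hg.
have mX := measurable_mxprod hGL n j0.
have bZ p : cess_bounded P (Z p) by exact: cess_bounded_twist e0 V0 hg mX.
have bZy p : ess_bounded P (fun w => cabs (Z p w - y p) ^+ 2).
  by apply: ess_bounded_sqr_cabs; apply: cess_boundedB => //; exact: cess_bounded_cst.
have vZ p : mean P (fun w => cabs (Z p w - y p) ^+ 2) <= 2 * kp.
  rewrite yE; apply: le_trans (mean_sqr_cabsB (bZ p) _) _.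
    by apply: aeW => w; rewrite cabs_twist; exact: hg.1.
  rewrite -yE; have := big p; rewrite -/n -/(y p).
  move: (cabs (y p)) => a ka; nra.
have bm := ess_bounded_move_dist P hGL n p1 p2 j0 (ltW e0).
have mm : mean P (move_dist A eps j n p1 p2) <= (tau ^+ 2) `^ eps / 4.
  apply: le_trans (contracts_mul hGL hI (ltW e0) (ltW c0) hc m p1 p2 j0) _.
  rewrite -[leRHS]mulr1; apply: ler_pM => //; rewrite ?exprn_ge0 ?(ltW c0) ?powR_ge0 //.
  by apply: powR_le1; rewrite ?pdist_ge0 ?pdist_le1 // ltW.
(* One functional for all requirements: where [Phi < 1], every twist on the grid is within [1 / 8]
   of its mean, since [64 / 8^2 = 1], and the images of [p1], [p2] are within [tau ^+ 2]. Its mean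
   is at most [1 / 2]. *)
pose Phi w := \sum_(k <- iota 0 N) 64 * cabs (Z (pk k) w - y (pk k)) ^+ 2
   + ((tau ^+ 2) `^ eps)^-1 * move_dist A eps j n p1 p2 w.
have bS : ess_bounded P (fun w => \sum_(k <- iota 0 N) 64 * cabs (Z (pk k) w - y (pk k)) ^+ 2).
  by apply: ess_bounded_sum => k; exact: ess_boundedZ.
have bPhi : ess_bounded P Phi by apply: ess_boundedD => //; exact: ess_boundedZ.
have mPhi : mean P Phi < 1.
  rewrite meanD //; last exact: ess_boundedZ.
  have s1 : mean P (fun w => \sum_(k <- iota 0 N) 64 * cabs (Z (pk k) w - y (pk k)) ^+ 2)
      <= 4^-1.
    apply: (mean_sum_le (b := 128 * kp)); last by rewrite size_iota.
      by move=> k; exact: ess_boundedZ.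
    move=> k; rewrite meanZ //; have := vZ (pk k); move: (mean _ _) => x hx.
    by lra.
  have s2 : mean P (fun w => ((tau ^+ 2) `^ eps)^-1 * move_dist A eps j n p1 p2 w) <= 4^-1.
    by rewrite meanZ // mulrC ler_pdivrMr // mulrC.
  by move: s1 s2; move: (mean _ _) (mean _ _) => a b; lra.
have [w hw Phw] := mean_lt_ex bPhi (ae_quasi_isometry_mxprod K1 hK n j0) mPhi.
have Sge0 : 0 <= \sum_(k <- iota 0 N) 64 * cabs (Z (pk k) w - y (pk k)) ^+ 2.
  by apply: sumr_ge0 => k _; rewrite mulr_ge0 // sqr_ge0.
have Dge0 : 0 <= ((tau ^+ 2) `^ eps)^-1 * move_dist A eps j n p1 p2 w.
  by rewrite mulr_ge0 ?powR_ge0 // invr_ge0 powR_ge0.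
have close k : (k < N)%N -> cabs (Z (pk k) w - y (pk k)) <= 8^-1.
  move=> kN; have : 64 * cabs (Z (pk k) w - y (pk k)) ^+ 2 <= 1.
    apply: le_trans (ltW Phw); rewrite /Phi.
    rewrite (bigD1_seq k) ?mem_iota ?iota_uniq //=.
    rewrite -addrA lerDl addr_ge0 // sumr_ge0 // => i _.
    by rewrite mulr_ge0 // sqr_ge0.
  have := cabs_ge0 (Z (pk k) w - y (pk k)); move: (cabs _) => a a0 ha.
  rewrite -(@ler_pXn2r _ 2) ?nnegrE ?(ltW e8) //.
  by rewrite (_ : 8^-1 ^+ 2 = 64^-1); [lra|field].
have dist12 : pdist (pact (mxprod A j n w) p1) (pact (mxprod A j n w) p2) <= tau ^+ 2.
  rewrite leNgt; apply/negP => hlt; move: Phw; apply/negP; rewrite -leNgt.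
  rewrite /Phi (le_trans _ (lerD Sge0 (lexx _))) // add0r.
  rewrite mulrC ler_pdivlMr // mul1r /move_dist.
  by apply: ge0_ler_powR; rewrite ?nnegrE ?(ltW e0) ?(ltW eta0) ?pdist_ge0 // ltW.
have uw := mxprod_unit hGL n w j0.
have EE : expR (pi / `|t|) <= E0.
  by rewrite ler_expR ler_wpM2l ?pi_ge0 // lef_pV2 ?posrE.
have hV s : 0 <= s -> s <= 8 * tau * E0 -> V * s `^ eps <= 8^-1.
  by move=> s0 sE; apply: hdl => //; exact: le_trans sE tau1.
have hw12 : wedge_norm (mxprod A j n w *m e1') (mxprod A j n w *m e2')
    <= tau ^+ 2 * (enorm (mxprod A j n w *m e1') * enorm (mxprod A j n w *m e2')).
  have [a1 a2] := (mulmx_unit_neq0 uw e10, mulmx_unit_neq0 uw e20).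
  have v1 : val (pact (mxprod A j n w) p1) = <[mxprod A j n w *m e1']>%VS.
    exact: val_pact_line.
  have v2 : val (pact (mxprod A j n w) p2) = <[mxprod A j n w *m e2']>%VS.
    exact: val_pact_line.
  by move: dist12; rewrite (pdistE a1 a2 v1 v2) ler_pdivrMr // mulr_gt0 ?enorm_gt0.
have hK2 : h * (K ^+ n) ^+ 2 <= tau ^+ 2 by rewrite /h /K2 divfK // gt_eqF.
have [s hs] : exists s, cabs (y (proj_line (x0 s))) <= 2^-1.
  apply: (pencil_gap d11 d22 d12 tau0 E01 tE1 tau2 t0 tT EE hV Kn1 uw hw hw12 h0 hK2 hg hLg).
  move=> z zK; have [k [kN kz]] := grid_point h0 zK.
  by exists (sk k); split => //; exact: close.
have := big (proj_line (x0 s)); rewrite -/n -/(y _) => hb.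
by move: hs hb kp1; move: (cabs _) => b; lra.
Qed.

End Gap.

(** * Exponential decay *)

Section HolderNorm.
Context (R : realType) (d : nat).
Implicit Types (g : projspace R d -> R[i]).

Lemma projspace_two_points : (2 <= d)%N -> exists p q : projspace R d, p <> q.
Proof.
move=> d2; have d1 : (0 < d)%N by exact: leq_trans d2.
pose a : 'I_d := Ordinal d1; pose b : 'I_d := Ordinal d2.
have nz (i : 'I_d) : delta_mx i 0 != 0 :> 'cV[R]_d.
  by apply/eqP => /matrixP/(_ i 0)/eqP; rewrite !mxE !eqxx oner_eq0.
exists (proj_line (nz a)), (proj_line (nz b)) => /(congr1 val); rewrite !val_proj_line => e.
have : (delta_mx a 0%R : 'cV[R]_d) \in <[delta_mx b 0%R : 'cV[R]_d]>%VS.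
  by rewrite -e memv_line.
case/vlineP => k /matrixP/(_ a 0)/eqP; rewrite !mxE !eqxx /= mulr0.
by rewrite oner_eq0.
Qed.

(** An empty supremum would be [-oo]. Two distinct lines make both suprema in [holder_norm]
    nonnegative, so each of them is bounded by their sum. *)
Lemma holder_norm_le1 (eps : R) g : (2 <= d)%N -> 0 < eps ->
  (holder_norm eps g <= 1)%E -> holder eps 1 1 g.
Proof.
move=> d2 e0; have [p [q pq]] := projspace_two_points d2.
rewrite /holder_norm; set S := ereal_sup _; set H := holder_const _ _ => hn.
have S0 : (0 <= S)%E.
  apply: (@le_trans _ _ (cabs (g p))%:E); first by rewrite lee_fin cabs_ge0.
  by apply: ereal_sup_ubound; exists p.
have H0 : (0 <= H)%E.
  apply: (@le_trans _ _ (cabs (g p - g q) / (pdist p q `^ eps))%:E).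
    by rewrite lee_fin divr_ge0 ?cabs_ge0 ?powR_ge0.
  by apply: ereal_sup_ubound; exists (p, q).
have S1 : (S <= 1)%E by apply: le_trans hn; exact: leeDl.
have H1 : (H <= 1)%E by apply: le_trans hn; exact: leeDr.
split=> [x|x y].
  by rewrite -lee_fin; apply: le_trans S1; apply: ereal_sup_ubound; exists x.
have [->|/eqP xy] := eqVneq x y.
  by rewrite subrr cabs0 mul1r powR_ge0.
rewrite mul1r; have dxy : 0 < pdist x y `^ eps by rewrite powR_gt0 // pdist_gt0.
rewrite -[leRHS]mul1r -ler_pdivrMr // -lee_fin; apply: le_trans H1.
by apply: ereal_sup_ubound; exists (x, y).
Qed.

Lemma holder_holder_norm (eps s v : R) g : holder eps s v g ->
  (holder_norm eps g <= (s + v)%:E)%E.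
Proof.
move=> [h1 h2]; rewrite EFinD; apply: leeD.
  by apply: ge_ereal_sup => _ [x _ <-]; rewrite lee_fin.
apply: ge_ereal_sup => _ [[x y] /= xy <-]; rewrite lee_fin.
by rewrite ler_pdivrMr // powR_gt0 // pdist_gt0.
Qed.

End HolderNorm.

Section Iteration.
Context (R : realType) (d : nat) (disp : measure_display)
  (T : measurableType disp) (P : probability T R) (A : nat -> T -> 'M[R]_d).
Hypothesis hGL : forall j, (0 < j)%N -> random_GL (A j).
Hypothesis hI : independent_seq P A.
Implicit Types (g : projspace R d -> R[i]).

(** One block multiplies both bounds by the same factor, so after division by [(1 - k2) ^+ i] the
    function is back in the class to which [step] applies. *)
Lemma transfer_iter_block (eps V k2 delta0 T0 : R) N : 0 < eps -> 0 <= V -> k2 < 1 ->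
  (forall j t g, (0 < j)%N -> delta0 <= `|t| <= T0 -> holder eps 1 V g ->
     holder eps (1 - k2) (V * (1 - k2)) (transfer_iter P A t j N g)) ->
  forall i j t g, (0 < j)%N -> delta0 <= `|t| <= T0 -> holder eps 1 V g ->
     holder eps ((1 - k2) ^+ i) (V * (1 - k2) ^+ i) (transfer_iter P A t j (N * i) g).
Proof.
move=> e0 V0 k21 step; elim=> [|i ih] j t g j0 ht hg.
  by rewrite muln0 mulr1.
rewrite mulnS transfer_iterD.
have jN0 : (0 < j + N)%N by rewrite addn_gt0 j0.
have hu := ih _ t g jN0 ht hg; set u := transfer_iter _ _ _ _ _ _ in hu *.
have q0 : 0 < (1 - k2) ^+ i by rewrite exprn_gt0 // subr_gt0.
set s := (1 - k2) ^+ i in q0 hu.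
have s0 : s != 0 by rewrite gt_eqF.
have si0 : 0 <= s^-1 by rewrite invr_ge0 ltW.
have hu1 : holder eps 1 V (fun p => Complex s^-1 0 * u p).
  by have := holderZ si0 hu; rewrite mulVf // (mulrC V) mulKf.
have := holderZ (ltW q0) (step j t _ j0 ht hu1).
rewrite (transfer_iterZ hGL hI t N j0 e0 _ si0 hu); last by rewrite mulr_ge0 // ltW.
have -> : (fun p => Complex s 0 * (Complex s^-1 0 * transfer_iter P A t j N u p))
    = transfer_iter P A t j N u.
  apply/funext => p; rewrite mulrA.
  have -> : Complex s 0 * Complex s^-1 0 = 1 :> R[i].
    by apply/eqP; rewrite eq_complex /= !mulr0 !mul0r divff // subr0 addr0 !eqxx.
  by rewrite mul1r.
by rewrite mulrCA exprSr.
Qed.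

End Iteration.

(** The rate is [- ln q / N], and rounding [n / N] down costs at most one factor [q^-1]. *)
Lemma expr_divn_le (R : realType) (q : R) (N : nat) : (0 < N)%N -> 0 < q -> q < 1 ->
  exists2 c : R, 0 < c & forall n : nat, q ^+ (n %/ N) <= q^-1 * expR (- c * n%:R).
Proof.
move=> N0 q0 q1; have lq : ln q < 0 by rewrite ln_lt0 // q0.
have NR : 0 < N%:R :> R by rewrite ltr0n.
exists (- ln q / N%:R); first by rewrite divr_gt0 // oppr_gt0.
move=> n; rewrite ler_pdivlMl //.
rewrite -exprS -{1}(lnK (q0 : q \is Num.pos)) -expRM_natl ler_expR.
have h : n%:R <= N%:R * (n %/ N).+1%:R :> R.
  by rewrite -natrM ler_nat mulnC ltnW // ltn_ceil.
have -> : - (- ln q / N%:R) * n%:R = ln q * (n%:R / N%:R) by ring.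
by rewrite mulrC ler_nM2l // ler_pdivrMr // mulrC.
Qed.

Theorem proposition4p4 (R : realType) (d : nat) (disp : measure_display)
    (T : measurableType disp) (P : probability T R)
    (A : nat -> T -> 'M[R]_d) (x : 'cV[R]_d) :
  (2 <= d)%N ->
  (forall j, (0 < j)%N -> random_GL (A j)) ->
  independent_seq P A ->
  uniformly_bounded P A ->
  log_contracting P A ->
  regular_distributions P A ->
  large_supports P A ->
  enorm x = 1 ->
  sigma P A x n @[n --> \oo] --> +oo ->
  exists eps0 : R, 0 < eps0 <= 1 /\
  forall eps : R, 0 < eps <= eps0 ->
  forall delta0 T0 : R, 0 < delta0 -> delta0 < T0 ->
  exists c C : R, [/\ 0 < c, 0 < C &
    forall n : nat, (1 <= n)%N ->
      (ereal_sup [set holder_opnorm eps (transfer_iter P A t 1 n)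
                 | t in [set t : R | (delta0 <= `|t| <= T0)%R]]
       <= (C * expR (- c * n%:R))%:E)%E].
Proof.
move=> d2 hGL hI hbd hlog hreg _ _ _.
have [K [K1 hK]] := uniformly_bounded_quasi_isometry hGL hbd.
have [n0 [eps0 [n00 he0 hcon]]] := log_contracting_contracts hGL K1 hK hlog.
exists eps0; split => // eps he delta0 T0 dl0 dT.
have e0 : 0 < eps by case/andP: he.
have he1 : 0 < eps <= 1.
  by rewrite e0 /= (le_trans (andP he).2) // (andP he0).2.
have [c [c0 c1 hc]] := hcon _ he.
have T00 : 0 <= T0 by rewrite ltW // (lt_trans dl0).
have c1' : 0 < 1 - c by rewrite subr_gt0.
have Kp n : 0 <= K ^+ n by rewrite exprn_ge0 // (le_trans _ K1).
pose B := 2 * T0 * (K ^+ n0) ^+ 2 / (1 - c).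
have B0 : 0 <= B by rewrite divr_ge0 ?(ltW c1') // !mulr_ge0.
(* [2 * B] makes [V / 2 + B <= V], so the class is preserved once the contraction factor is at most
   [1 / 2]. The summand 2 leaves room for an error 1 in the last stage of a block, where [V] is
   multiplied by [1 - k2 >= 1 / 2]. *)
pose V := 2 * B + 2; have V1 : 0 < V by rewrite ltr_wpDl // mulr_ge0.
have V0 := ltW V1.
have [m [kappa [kp0 cm gap]]] := transfer_iter_gap hGL hI K1 hK d2 he1 c0 c1 hc V0 dl0 dT.
have [k [k2 [k20 k2h spread]]] := transfer_iter_spread hGL hI hreg e0 V0 kp0.
pose D n := K ^+ n ^+ 4 * V + 2 * T0 * (K ^+ n) ^+ 2 * 1.
have D0 n : 0 < D n.
  rewrite ltr_pwDl // ?mulr_ge0 // mulr_gt0 // !exprn_gt0 //.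
  exact: lt_le_trans ltr01 K1.
(* The rounds needed to undo the growth [D k] of the Hoelder constant; [a.+1] rather than [a]
   ensures that a block is not empty. *)
have [a ha] : exists a, c ^+ a.+1 * D k <= 1.
  have [a ha] : exists a, c ^+ a <= (D k)^-1.
    by apply: expr_small; rewrite ?invr_gt0 ?(ltW c0).
  exists a; rewrite -ler_pdivlMr // mul1r (le_trans _ ha) // exprS.
  by rewrite ler_piMl ?exprn_ge0 ?(ltW c0) // ltW.
(* The operators act from the right: [n0 * m] of them create a gap at one point, [k] spread it to
   all points, and [n0 * a.+1] restore the Hoelder constant. *)
pose N := (n0 * a.+1 + (k + n0 * m))%N.
have N0 : (0 < N)%N by rewrite addn_gt0 muln_gt0 n00.
have step j t g : (0 < j)%N -> delta0 <= `|t| <= T0 -> holder eps 1 V g ->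
    holder eps (1 - k2) (V * (1 - k2)) (transfer_iter P A t j N g).
  move=> j0 ht hg; have tT := (andP ht).2.
  rewrite transfer_iterD transfer_iterD.
  set j1 := (j + n0 * a.+1)%N; set j2 := (j1 + k)%N.
  have j10 : (0 < j1)%N by rewrite addn_gt0 j0.
  have j20 : (0 < j2)%N by rewrite addn_gt0 j10.
  set u := transfer_iter P A t j2 _ g.
  have hu : holder eps 1 V u.
    have := holder_transfer_iter_mul hGL hI K1 hK m he1 (ltW c0) c1 ler01 V0 tT j20 hc hg.
    apply: holderW => //; rewrite -/B mulr1.
    have : c ^+ m * V <= 2^-1 * V by rewrite ler_wpM2r.
    by rewrite /V; lra.
  have gp := gap j2 t g j20 ht hg hu.
  have sp := spread j1 t u j10 hu gp.
  set v := transfer_iter P A t j1 k u.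
  have hv : holder eps (1 - k2) (D k) v.
    have hv1 := holder_transfer_iter hGL hI K1 hK he1 ler01 V0 tT j10
      (contracts_trivial hGL K1 hK k he1) hu.
    by split; [exact: sp|exact: hv1.2].
  have q0 : 0 <= 1 - k2 by lra.
  have := holder_transfer_iter_mul hGL hI K1 hK a.+1 he1 (ltW c0) c1 q0 (ltW (D0 k)) tT j0 hc hv.
  apply: holderW => //; rewrite -/B /V.
  have : 0 <= B * (1 - k2) by rewrite mulr_ge0.
  have q2 : 2^-1 <= 1 - k2 by lra.
  by move: ha q2; move: (c ^+ _ * D k) (1 - k2) => z q hz q2 Bq; lra.
have k21 : k2 < 1 by lra.
have q0 : 0 < 1 - k2 by rewrite subr_gt0.
have q1 : 1 - k2 < 1 by lra.
have block := transfer_iter_block hGL hI e0 V0 k21 step.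
have [c' c'0 hc'] := expr_divn_le N0 q0 q1.
pose C := (1 + D N) * (1 - k2)^-1.
exists c', C; split => //.
  by rewrite mulr_gt0 ?invr_gt0 // addr_gt0.
move=> n n1; apply: ge_ereal_sup => _ [t /= ht <-].
apply: ge_ereal_sup => _ [g /= hg <-].
have tT := (andP ht).2.
have hg1 := holder_norm_le1 d2 e0 hg.
have hgV : holder eps 1 V g.
  by apply: holderW hg1 => //; rewrite /V; lra.
(* The incomplete block is put outermost: the full blocks start at index [1 + r], which is harmless
   as [block] is uniform in the starting index, and the remaining [r] operators cost at most
   [1 + D N]. *)
pose r := (n %% N)%N; pose i := (n %/ N)%N.
have nE : n = (r + N * i)%N by rewrite /r /i mulnC addnC -divn_eq.
rewrite nE transfer_iterD.
have hb := block i (1 + r)%N t g isT ht hgV.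
have qi0 : 0 <= (1 - k2) ^+ i by rewrite exprn_ge0 // ltW.
have := holder_transfer_iter hGL hI K1 hK he1 qi0 (mulr_ge0 V0 qi0) tT (isT : (0 < 1)%N)
  (contracts_trivial hGL K1 hK r he1) hb.
move=> /holder_holder_norm /le_trans; apply; rewrite lee_fin -nE.
have rN : (r <= N)%N by rewrite ltnW // ltn_mod.
have KrN : K ^+ r <= K ^+ N by rewrite ler_weXn2l.
have DrN : D r <= D N.
  apply: lerD.
    by rewrite ler_wpM2r // lerXn2r ?nnegrE.
  by rewrite ler_wpM2r // ler_wpM2l ?mulr_ge0 // lerXn2r ?nnegrE.
have -> : (1 - k2) ^+ i + (K ^+ r ^+ 4 * (V * (1 - k2) ^+ i)
     + 2 * T0 * K ^+ r ^+ 2 * (1 - k2) ^+ i) = (1 + D r) * (1 - k2) ^+ i.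
  by rewrite /D; ring.
apply: (@le_trans _ _ ((1 + D N) * (1 - k2) ^+ i)).
  by rewrite ler_wpM2r // lerD2l.
rewrite /C -mulrA ler_wpM2l ?hc' //.
by rewrite addr_ge0 // ltW.
Qed.
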